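(* Let $n\ge3$ and let $B_1$ be the unit ball of $\mathbb R^n$ centered at $0$. There exist a bounded sequence $(d_N)$ in $L^{\frac n2,1}(B_1)$ and a sequence $(u_N)$ of nonnegative functions in $W_0^{1,2}(B_1)\cap C(\overline{B_1})$ such that, for all $N\in\mathbb N$, $u_N$ is a solution to the equation $-\Delta u_N+d_Nu_N=0$ in $B_1$, and $$\|u_N\|_{W_0^{1,2}(B_1)}\le C\ \text{ for some constant } C \text{ independent of } N,\qquad\text{while}\qquad u_N(0)\xrightarrow[N\to\infty]{}\infty.$$
   Context: Functions are real valued. For measurable $h$ on $B_1$, $h^*(\tau)=\inf\{t>0:|\{x\in B_1:|h(x)|>t\}|\le\tau\}$ and $\|h\|_{L^{\frac n2,1}(B_1)}=\int_0^\infty\tau^{\frac2n}h^*(\tau)\frac{d\tau}{\tau}$. $W_0^{1,2}(B_1)$ is the closure of $C_c^\infty(B_1)$ under $\|u\|_{W^{1,2}(B_1)}=\|u\|_{L^2(B_1)}+\|\nabla u\|_{L^2(B_1)}$. $u$ is a solution to $-\Delta u+du=0$ in $B_1$ if $\int_{B_1}\nabla u\cdot\nabla\phi+du\phi=0$ for all $\phi\in C_c^\infty(B_1)$. *)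

(* Defs.v *)
From HB Require Import structures.
From mathcomp Require Import all_boot all_order all_algebra.
From mathcomp Require Import all_classical all_reals all_analysis.

Set Implicit Arguments.
Unset Strict Implicit.
Unset Printing Implicit Defensive.

Import Order.TTheory GRing.Theory Num.Theory.
Import numFieldNormedType.Exports.

Local Open Scope classical_set_scope.
Local Open Scope ring_scope.

(** R^n is ['rV[R]_n].  It carries the sigma-algebra generated by the
    coordinate maps, that is, the Borel sigma-algebra. *)

Definition rV_display : measure_display.
Proof. exact: default_measure_display. Qed.

Section measurable_rV.
Context (R : realType) (n : nat).

Let coord (i : 'I_n) (x : 'rV[R]_n) : R := x 0 i.

Let rV_set0 : g_sigma_preimage coord set0.
Proof. exact: sigma_algebra0. Qed.

Let rV_setC A : g_sigma_preimage coord A -> g_sigma_preimage coord (~` A).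
Proof. exact: sigma_algebraC. Qed.

Let rV_bigcup (F : (set _)^nat) : (forall i, g_sigma_preimage coord (F i)) ->
  g_sigma_preimage coord (\bigcup_i (F i)).
Proof. exact: sigma_algebra_bigcup. Qed.

HB.instance Definition _ := @isMeasurable.Build rV_display
  'rV[R]_n (g_sigma_preimage coord) rV_set0 rV_setC rV_bigcup.

End measurable_rV.

Lemma measurable_coord (R : realType) n (i : 'I_n) :
  measurable_fun setT (fun x : 'rV[R]_n => x 0 i).
Proof.
move=> _ Y mY; rewrite setTI; apply: sub_sigma_algebra => /=.
rewrite -bigcup_seq/=; exists i => /=; first by rewrite mem_index_enum.
by exists Y => //; rewrite setTI.
Qed.

Lemma measurable_fun_rVP d (T : measurableType d) (R : realType) n
    (f : T -> 'rV[R]_n) :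
  measurable_fun setT f <->
  forall i, measurable_fun setT (fun t => f t 0 i).
Proof.
split=> [mf i|mf].
  exact: (measurableT_comp (measurable_coord i) mf).
suff : measurable `<=` [set A | measurable (f @^-1` A)].
  by move=> H _ A mA; rewrite setTI; exact: H.
apply: smallest_sub.
  split=> /= [|A mA|F mF]; first by rewrite preimage_set0.
    by rewrite setTD preimage_setC; exact: measurableC.
  by rewrite preimage_bigcup; exact: bigcup_measurable.
elim/big_ind: _ => [//|A B HA HB x [/HA|/HB]//|i _ A [B mB <-]] /=.
rewrite setTI -[X in measurable X]setTI; exact: mf.
Qed.

(** [rV_cons (t, x)] is the vector [(t, x_0, ..., x_(n-1))]. *)
Definition rV_cons (R : realType) n (p : measurableTypeR R * 'rV[R]_n) :
    'rV[R]_n.+1 :=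
  \row_i oapp (fun j => p.2 0 j) p.1 (unlift ord0 i).

Definition rV_uncons (R : realType) n (x : 'rV[R]_n.+1) :
    measurableTypeR R * 'rV[R]_n :=
  (x 0 ord0, \row_j x 0 (lift ord0 j)).

Lemma rV_consK (R : realType) n : cancel (@rV_cons R n) (@rV_uncons R n).
Proof.
move=> [t x]; congr pair; first by rewrite mxE unlift_none.
by apply/rowP => j; rewrite !mxE liftK.
Qed.

Lemma rV_unconsK (R : realType) n : cancel (@rV_uncons R n) (@rV_cons R n).
Proof.
move=> x; apply/rowP => i; rewrite mxE.
by case: unliftP => [j ->|->] /=; rewrite ?mxE.
Qed.

Lemma measurable_rV_cons (R : realType) n : measurable_fun setT (@rV_cons R n).
Proof.
apply/measurable_fun_rVP => i.
case: (unliftP ord0 i) => [j ->|->].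
- rewrite (_ : (fun _ => _) = (fun x : 'rV[R]_n => x 0 j) \o snd).
    exact: (measurableT_comp (measurable_coord j) measurable_snd).
  by apply/funext => -[t x]; rewrite mxE liftK.
- rewrite (_ : (fun _ => _) = fst); first exact: measurable_fst.
  by apply/funext => -[t x]; rewrite mxE unlift_none.
Qed.

Lemma measurable_rV_uncons (R : realType) n :
  measurable_fun setT (@rV_uncons R n).
Proof.
apply/measurable_fun_pairP; split; first exact: measurable_coord.
apply/measurable_fun_rVP => j.
rewrite (_ : (fun _ => _) = fun x : 'rV[R]_n.+1 => x 0 (lift ord0 j)).
  exact: measurable_coord.
by apply/funext => x /=; rewrite mxE.
Qed.

Section lebesgue_rV_succ.
Context (R : realType) (n : nat).
Variable mu : {sigma_finite_measure set 'rV[R]_n -> \bar R}.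

Definition lebesgue_rV_succ : set 'rV[R]_n.+1 -> \bar R :=
  pushforward (lebesgue_measure \x mu)%E (@rV_cons R n).

Let succ0 : lebesgue_rV_succ set0 = 0%E.
Proof. by rewrite /lebesgue_rV_succ /pushforward preimage_set0 measure0. Qed.

Let succ_ge0 A : (0 <= lebesgue_rV_succ A)%E.
Proof. by apply: (measure_ge0 (lebesgue_measure \x mu)%E). Qed.

Let succ_sigma_additive : semi_sigma_additive lebesgue_rV_succ.
Proof.
move=> F mF tF mUF; rewrite /lebesgue_rV_succ /pushforward preimage_bigcup.
have mcons A : measurable A -> measurable (@rV_cons R n @^-1` A).
  by move=> mA; rewrite -[X in measurable X]setTI; exact: measurable_rV_cons.
apply: (@measure_semi_sigma_additive _ _ _ (lebesgue_measure \x mu)%E).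
- by move=> k; exact: mcons.
- apply/trivIsetP => /= i j _ _ ij; rewrite -preimage_setI.
  by move/trivIsetP : tF => /(_ _ _ _ _ ij) ->//; rewrite preimage_set0.
- by rewrite -preimage_bigcup; exact: mcons.
Qed.

HB.instance Definition _ := isMeasure.Build _ _ _ lebesgue_rV_succ
  succ0 succ_ge0 succ_sigma_additive.

Let succ_sigma_finite : sigma_finite setT lebesgue_rV_succ.
Proof.
have /sigma_finiteP[F [TF ndF Foo]] := sigma_finiteT (@lebesgue_measure R).
have /sigma_finiteP[G [TG ndG Goo]] := sigma_finiteT mu.
exists (fun k => @rV_uncons R n @^-1` (F k `*` G k)).
  rewrite -preimage_bigcup -[LHS](preimage_setT (@rV_uncons R n)).
  congr (_ @^-1` _); rewrite -setXTT TF TG predeqE => -[x y]; split.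
    move=> [/= [k _ Fkx] [l _ Gly]]; exists (maxn k l) => //; split.
    - by move: x Fkx; exact/subsetPset/ndF/leq_maxl.
    - by move: y Gly; exact/subsetPset/ndG/leq_maxr.
  by move=> [k _ []/= ? ?]; split; exists k.
move=> k; have [? ?] := Foo k; have [? ?] := Goo k; split.
  rewrite -[X in measurable X]setTI; apply: measurable_rV_uncons => //.
  exact: measurableX.
rewrite /lebesgue_rV_succ /pushforward -comp_preimage.
rewrite (_ : _ \o _ = id); last by apply/funext => p /=; rewrite rV_consK.
by rewrite preimage_id product_measure1E// lte_mul_pinfty// ge0_fin_numE.
Qed.

HB.instance Definition _ := Measure_isSigmaFinite.Build _ _ _ lebesgue_rV_succ
  succ_sigma_finite.

End lebesgue_rV_succ.

(** n-dimensional Lebesgue measure: the n-fold product of the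
    one-dimensional one. *)
Fixpoint lebesgue_rV (R : realType) n :
    {sigma_finite_measure set 'rV[R]_n -> \bar R} :=
  match n return {sigma_finite_measure set 'rV[R]_n -> \bar R} with
  | 0 => \d_(0 : 'rV[R]_0)
  | n'.+1 => lebesgue_rV_succ (lebesgue_rV R n')
  end.

Lemma lebesgue_rV_box (R : realType) n (A : 'I_n -> set R) :
  (forall i, measurable (A i)) ->
  lebesgue_rV R n [set x | forall i, A i (x 0 i)] =
  (\prod_(i < n) lebesgue_measure (A i))%E.
Proof.
elim: n A => [|n IH] A mA.
  by rewrite big_ord0 /= diracE mem_set// => -[].
rewrite big_ord_recl -IH//= /lebesgue_rV_succ /pushforward.
have mB : measurable [set x : 'rV[R]_n | forall i, A (lift ord0 i) (x 0 i)].
  rewrite (_ : [set _ | _] = \bigcap_(i in [set: 'I_n])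
      ((fun x : 'rV[R]_n => x 0 i) @^-1` A (lift ord0 i))); last first.
    by apply/seteqP; split=> x /= h => [i _|i]; exact: h.
  apply: fin_bigcap_measurable => // i _.
  by rewrite -[X in measurable X]setTI; exact: measurable_coord.
rewrite [LHS](_ : _ = (lebesgue_measure \x lebesgue_rV R n)%E (A ord0 `*`
    [set x : 'rV[R]_n | forall i, A (lift ord0 i) (x 0 i)])).
  exact: (product_measure1E lebesgue_measure (lebesgue_rV R n) (mA ord0) mB).
congr (_ _); apply/seteqP; split=> -[t x] /=.
  move=> h; split=> [|j].
    by have := h ord0; rewrite mxE unlift_none.
  by have := h (lift ord0 j); rewrite mxE liftK.
move=> [At Ax] i; rewrite mxE.
by case: unliftP => [j ->|->] //=; exact: Ax.
Qed.

Section euclidean.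
Context (R : realType) (n : nat).
Implicit Types x y : 'rV[R]_n.

(** The library norm of ['rV[R]_n] is the sup norm, hence these. *)
Definition dot x y : R := \sum_(i < n) x 0 i * y 0 i.

Definition enorm x : R := Num.sqrt (dot x x).

Definition unit_ball : set 'rV[R]_n := [set x | enorm x < 1].

End euclidean.
Arguments unit_ball : clear implicits.

Section function_spaces.
Context (R : realType) (n : nat).
Local Notation V := 'rV[R]_n.
Local Notation B1 := (unit_ball R n).
Local Notation mu := (lebesgue_rV R n).

Implicit Types (phi d h u : V -> R) (Du : V -> V).

Definition partial (i : 'I_n) phi : V -> R :=
  fun x => 'D_(delta_mx 0 i) phi x.

Definition grad phi : V -> V := fun x => \row_i partial i phi x.

Definition smooth phi : Prop :=
  forall (s : seq 'I_n) x, differentiable (foldr partial phi s) x.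

(** Elements of C_c^oo(B_1), extended by zero to R^n. *)
Definition test_function phi : Prop :=
  [/\ smooth phi, compact (closure [set x | phi x != 0])
    & closure [set x | phi x != 0] `<=` B1].

Definition L2norm h : \bar R := ('N[mu]_2%:E [(EFin \o h) \_ B1])%E.

Definition W12norm u Du : \bar R :=
  (L2norm u + L2norm (fun x => enorm (Du x)))%E.

(** [W12 u Du]: u is in W^{1,2}(B_1), with weak gradient Du (which is
    determined by u up to a null set). *)
Definition W12 u Du : Prop :=
  [/\ measurable_fun B1 u, measurable_fun B1 Du, (W12norm u Du < +oo)%E &
    forall phi, test_function phi -> forall i,
      (\int[mu]_(x in B1) (u x * partial i phi x)%:E =
       - \int[mu]_(x in B1) (Du x 0 i * phi x)%:E)%E].

Definition W012 u Du : Prop :=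
  W12 u Du /\
  forall e : R, 0 < e -> exists2 phi, test_function phi &
    (W12norm (fun x => u x - phi x)%R (fun x => Du x - grad phi x)%R < e%:E)%E.

(** Weak solution of -Delta u + d u = 0 in B_1, where Du is the weak
    gradient of u.  Integrability is required explicitly since the library
    integral is total. *)
Definition weak_solution d u Du : Prop :=
  forall phi, test_function phi ->
    let F x := (dot (Du x) (grad phi x) + d x * u x * phi x)%:E in
    mu.-integrable B1 F /\ (\int[mu]_(x in B1) F x = 0)%E.

Definition rearrangement h (tau : R) : \bar R :=
  ereal_inf [set t%:E | t in
    [set t : R | 0 < t /\ (mu [set x | B1 x /\ (t < `|h x|)%R] <= tau%:E)%E]].

(** The norm of L^{n/2,1}(B_1). *)
Definition lorentz_norm h : \bar R :=
  (\int[lebesgue_measure]_(tau in `]0%R, +oo[)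
     ((tau `^ (2 / n%:R))%:E * rearrangement h tau * (tau^-1)%:E))%E.

End function_spaces.

(* Main.v *)
(** With [p = n - 2] and [0 < eta < 1], let [s] and [r] be the powers -1/2 of [eta^4 + |x|^2] and
    [1 + eta^4 |x|^2].  Both [s^p] (the Aubin-Talenti bubble) and [r^p] (its Kelvin transform)
    solve [Delta w = - n p eta^4 w^((p+4)/p)], so [u = eta^p (s^p - r^p)] is smooth on the whole
    space, positive exactly in [B_1], and [Delta u = d u] with [|d| <= 5 n p eta^4 s^4] in [B_1]:
    near the unit sphere the zeros of [u] and [Delta u] cancel.  The bound on [d] and the energy
    of [u] are invariant under scaling, whereas [u(0) = eta^(-p) - eta^p] blows up as [eta -> 0].
    Since [u] is smooth, [u theta(u/delta - 1)] with [theta(z) = exp(-1/z) 1_(z > 0)] is a test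
    function, and it tends to [u] in [W^{1,2}] as [delta -> 0]. *)
Require Import Defs.
From mathcomp Require Import all_boot all_order all_algebra.
From mathcomp Require Import all_classical all_reals all_analysis.
From mathcomp Require Import measurable_realfun ring lra.

Import Order.TTheory GRing.Theory Num.Theory.
Import numFieldNormedType.Exports.

Local Open Scope classical_set_scope.
Local Open Scope ring_scope.

Set Implicit Arguments.
Unset Strict Implicit.
Unset Printing Implicit Defensive.

(** * Borel sets and integration by parts in R^n *)

(** The bubble [s^p] alone does not vanish on the unit sphere, and subtracting a constant would not
    do: its Laplacian would stay nonzero where [u] vanishes, so [d = Delta u / u] would grow like
    [1 / (1 - |x|)], which is not in L^{n/2}. The Kelvin transform agrees with the bubble on the
    sphere, and so does its Laplacian; hence the quotient stays bounded up to the sphere. The fourth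
    power of [eta] encodes concentration at scale [eta^2]: there [u] has size [eta^(-p)] and its
    gradient [eta^(-p-2)], on a volume of order [eta^(2n)], so the gradient energy has order
    [eta^(2n-2p-4) = 1]. Cubes are the only sets whose volume is computed. Dyadic shells and level
    sets are enclosed in cubes, which costs constants only, and integration by parts is Fubini along
    one coordinate, for functions that vanish outside a cube. *)

Section rV_topology_measure.
Context (R : realType) (n : nat).
Local Notation V := 'rV[R]_n.
Local Notation mu := (lebesgue_rV R n).

Lemma measurable_rV_box (A : 'I_n -> set R) : (forall i, measurable (A i)) ->
  measurable [set x : V | forall i, A i (x 0 i)].
Proof.
move=> mA.
rewrite (_ : [set _ | _] = \bigcap_(i in [set: 'I_n])
    ((fun x : V => x 0 i) @^-1` A i)); last first.
  by apply/seteqP; split=> x /= h => [i _|i]; exact: h.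
apply: fin_bigcap_measurable => // i _.
by rewrite -[X in measurable X]setTI; exact: measurable_coord.
Qed.

(** An open set is the union of the boxes it contains that have a rational centre and half-width
    [1/(k+1)]. These are countably many, and boxes are measurable for the sigma-algebra of the
    coordinates. *)
Lemma open_measurable_rV (O : set V) : open O -> measurable O.
Proof.
move=> oO.
pose box (p : 'rV[rat]_n * nat) : set V :=
  [set x | forall i, `](ratr (p.1 0 i) - p.2.+1%:R^-1),
                       (ratr (p.1 0 i) + p.2.+1%:R^-1)[%classic (x 0 i)].
rewrite (_ : O = \bigcup_(p : 'rV[rat]_n * nat)
    if pselect (box p `<=` O) then box p else set0); last first.
  apply/seteqP; split=> [x Ox|x [p _]]; last first.
    by case: pselect => // bO /bO.
  have /nbhs_ballP[e /= e0 xeO] : nbhs x O by exact: open_nbhs_nbhs.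
  (* The radius [e] is halved: the rational centre is within [1/(k+1)] of [x], and the points of the
     box are within [1/(k+1)] of the centre. *)
  have [k k0] : exists k : nat, k.+1%:R^-1 < e / 2.
    have /cvgrPdist_lt/(_ _ (divr_gt0 e0 (ltr0n _ 2)))[k _ /(_ k (leqnn k))] :=
      @cvg_harmonic R.
    by rewrite /= sub0r normrN ger0_norm//; exists k.
  have hq i : exists q : rat, `|x 0 i - ratr q| < k.+1%:R^-1.
    have [|q] := @rat_in_itvoo _ (x 0 i - k.+1%:R^-1) (x 0 i + k.+1%:R^-1).
      by rewrite ltrD2l gtrN// invr_gt0.
    by rewrite in_itv/= => qx; exists q; rewrite ltr_distlC.
  pose q := \row_i projT1 (cid (hq i)).
  have qx i : `|x 0 i - ratr (q 0 i)| < k.+1%:R^-1.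
    by rewrite mxE; exact: (projT2 (cid (hq i))).
  exists (q, k) => //=; case: pselect => [_ i|[]].
    by have := qx i; rewrite /= in_itv/= ltr_distl.
  move=> y yq; apply: xeO; split=> // a j; rewrite (ord1 a).
  have := yq j; rewrite /= in_itv/= -ltr_distl => yqj.
  rewrite /ball/= (le_lt_trans (ler_distD (ratr (q 0 j)) _ _))//.
  by rewrite [ltRHS]splitr ltrD ?(lt_trans _ k0)// distrC.
apply: countable_bigcupT_measurable => [|p]; first exact: countableP.
case: pselect => [bO|nO]; last exact: measurable0.
apply: (@measurable_rV_box (fun i => `](ratr (p.1 0 i) - p.2.+1%:R^-1),
                                       (ratr (p.1 0 i) + p.2.+1%:R^-1)[%classic)).
by move=> i; exact: measurable_itv.
Qed.

Lemma continuous_measurable_rV (f : V -> R) :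
  continuous f -> measurable_fun setT f.
Proof.
move=> /continuousP cf; apply: (measurability _ (RGenOpens.measurableE R)).
move=> _ [_ [a [b ->] <-]]; rewrite setTI; apply: open_measurable_rV.
by apply: cf; exact: interval_open.
Qed.

Lemma integrable_bounded_support (g : V -> R) (M : R) :
  measurable_fun setT g -> (forall x, `|g x| <= M) ->
  (forall x : V, (exists j, 1 <= `|x 0 j|) -> g x = 0) ->
  mu.-integrable setT (EFin \o g).
Proof.
move=> mg gM g0.
pose A : set V := [set x | forall i, `]-1, 1[%classic (x 0 i)].
have mA : measurable A.
  by apply: (@measurable_rV_box (fun=> `]-1, 1[%classic)) => i; exact: measurable_itv.
have -> : EFin \o g = (EFin \o g) \_ A.
  apply/funext => x; rewrite patchE /=; case: ifPn => // /negP xA.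
  rewrite g0//; apply: contrapT => nx; apply: xA; rewrite inE => i /=.
  by rewrite in_itv/= -ltr_norml ltNge; apply/negP => xi; apply: nx; exists i.
apply/(integrable_mkcond _ mA).1; apply: measurable_bounded_integrable => //.
- rewrite [X in (X < _)%E](@lebesgue_rV_box _ _ (fun=> `]-1, 1[%classic)) => [|i];
    last exact: measurable_itv.
  under eq_bigr do rewrite lebesgue_measure_itv/= lte_fin gtrN// -EFinD.
  by rewrite prodEFin ltry.
- exact: measurable_funTS.
- by exists M; split; rewrite ?num_real// => x /ltW Mx y _; exact: le_trans Mx.
Qed.

End rV_topology_measure.

Section integral_partial.
Context (R : realType).

Lemma rV_cons_shift n (h : R) (t : R) (x : 'rV[R]_n) :
  h *: delta_mx 0 ord0 + rV_cons (t, x) = rV_cons (h + t, x) :> 'rV[R]_n.+1.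
Proof.
apply/rowP => k; rewrite !mxE /=.
by case: unliftP => [j ->|->] /=; rewrite ?mulr0 ?add0r ?mulr1.
Qed.

Lemma rV_cons_shift_lift n (j : 'I_n) (h : R) (t : R) (x : 'rV[R]_n) :
  h *: delta_mx 0 (lift ord0 j) + rV_cons (t, x) =
  rV_cons (t, h *: delta_mx 0 j + x) :> 'rV[R]_n.+1.
Proof.
apply/rowP => k; rewrite !mxE /=; case: unliftP => [l ->|->] /=.
  by rewrite !mxE (inj_eq lift_inj).
by rewrite mulr0 add0r.
Qed.

(* Only directional regularity is assumed, so that the hypotheses pass to the slices
   [w (rV_cons (t, _))] in the induction on [n]. *)
Lemma integral_partial n (i : 'I_n) (w : 'rV[R]_n -> R) (M : R) :
  (forall x, derivable w x (delta_mx 0 i)) ->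
  (forall x, continuous (fun h : R => partial i w (h *: delta_mx 0 i + x))) ->
  measurable_fun setT (partial i w) ->
  (forall x, `|partial i w x| <= M) ->
  (forall x : 'rV[R]_n, (exists j, 1 <= `|x 0 j|) -> w x = 0 /\ partial i w x = 0) ->
  (\int[lebesgue_rV R n]_x (partial i w x)%:E = 0)%E.
Proof.
elim: n i w => [[]//|n IH] i w dw cw mw wM w0.
have iw := integrable_bounded_support mw wM (fun x h => (w0 x h).2).
have /measurable_EFinP mEw := mw.
have iprod : (lebesgue_measure \x lebesgue_rV R n)%E.-integrable setT
    ((EFin \o partial i w) \o @rV_cons R n).
  apply/integrableP; split.
    exact: (measurableT_comp mEw (measurable_rV_cons (n:=n))).
  move/integrableP : iw => [_].
  rewrite ge0_integral_pushforward//.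
  - exact: measurable_rV_cons.
  - exact: measurableT_comp.
rewrite [LHS](_ : _ = \int[(lebesgue_measure \x lebesgue_rV R n)%E]_p
    ((EFin \o partial i w) \o @rV_cons R n) p)%E; last first.
  rewrite [LHS](integral_pushforward (measurable_rV_cons (n:=n)) (D := setT))//.
case: (unliftP ord0 i) => [j ij|i0].
(* The direction lies in the slice of fixed first coordinate [t]: that slice is integrated first,
   and its integral vanishes by induction. *)
- rewrite -integral12_prod_meas1//; apply: (integral0_eq lebesgue_measure) => t _.
  rewrite /fubini_F/=.
  have E x : partial i w (rV_cons (t, x)) =
      partial j (fun y => w (rV_cons (t, y))) x.
    rewrite /partial /derive ij.
    by under eq_fun do rewrite /= rV_cons_shift_lift.
  under eq_integral do rewrite E.
  apply: IH => [x|x||x|x [k xk]].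
  + have := dw (rV_cons (t, x)); rewrite /derivable ij.
    by under eq_fun do rewrite /= rV_cons_shift_lift.
  + have := cw (rV_cons (t, x)); rewrite ij.
    by under eq_fun do rewrite /= rV_cons_shift_lift -ij E.
  + rewrite -(_ : (fun x => partial i w (rV_cons (t, x))) = partial j _).
      apply: (measurableT_comp mw).
      exact: (measurableT_comp (measurable_rV_cons (n:=n)) (pair1_measurable t)).
    by apply/funext => x; rewrite E.
  + by rewrite -E.
  + by rewrite -E; apply: w0; exists (lift ord0 k); rewrite mxE liftK.
(* The direction is the first coordinate: it is integrated first, by the fundamental theorem of
   calculus on [-1, 1], and [F] vanishes at both ends. *)
- rewrite -integral21_prod_meas1//; apply: (integral0_eq (lebesgue_rV R n)) => x _.
  rewrite /fubini_G/=.
  pose F (t : R) := w (rV_cons (t, x)).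
  have E t : partial i w (rV_cons (t, x)) = derive1 F t.
    rewrite /partial /derive /derive1 i0.
    by under eq_fun do rewrite /= rV_cons_shift.
  have dF t : derivable F t 1.
    have := dw (rV_cons (t, x)); rewrite /derivable i0.
    under eq_fun do rewrite /= rV_cons_shift.
    by under [X in _ -> cvg (X @ _)]eq_fun do rewrite /F [_%:A]mulr1.
  have cF : continuous F.
    by move=> t; exact/differentiable_continuous/derivable1_diffP.
  have F0 t : 1 <= `|t| -> F t = 0 /\ derive1 F t = 0.
    by move=> t1; rewrite -E; apply: w0; exists ord0; rewrite mxE unlift_none.
  under eq_integral do rewrite E.
  rewrite (_ : (fun t => _) = (EFin \o derive1 F) \_ `[-1, 1]); last first.
    apply/funext => t; rewrite patchE; case: ifPn => // /negP tn.
    rewrite (F0 t _).2// leNgt; apply/negP => /ltW; rewrite ler_norml => t1.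
    by apply: tn; rewrite inE/= in_itv.
  rewrite -integral_mkcond (@continuous_FTC2 _ _ F)//.
  + by rewrite !(F0 _ _).1 ?subee// ?normrN normr1.
  + apply: continuous_subspaceT => t.
    have := cw (rV_cons (0, x)); rewrite i0.
    under eq_fun do rewrite /= rV_cons_shift addr0 -i0 E.
    exact.
  + split => [t _|//|]; first exact: dF.
    * exact/cvg_at_right_filter/cF.
    * exact/cvg_at_left_filter/cF.
Qed.

End integral_partial.

(** * Smooth functions *)

Section theta.
Context (R : realType).
Implicit Types (k : nat) (s : R).

(* The extra power [k] makes the family stable under derivation. *)
Definition theta k s : R := if 0 < s then s^-1 ^+ k * expR (- s^-1) else 0.

(** One term of the exponential series, [y^(k+2) / (k+2)! <= exp y] at [y = 1/s]. The quadratic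
    bound makes the difference quotient of [theta k] at 0 of order [|h|], so the derivative there is
    0. *)
Lemma theta_le k s : `|theta k s| <= k.+2`!%:R * s ^+ 2.
Proof.
rewrite /theta; case: ifPn => [s0|_]; last first.
  by rewrite normr0 mulr_ge0// sqr_ge0.
rewrite ger0_norm ?mulr_ge0 ?exprn_ge0 ?invr_ge0 ?expR_ge0 ?(ltW s0)//.
have y0 : 0 <= s^-1 by rewrite invr_ge0 ltW.
have := expR_ge1Dxn k.+1 y0 => h.
have {}h : s^-1 ^+ k.+2 <= k.+2`!%:R * expR s^-1.
  rewrite mulrC -ler_pdivrMr ?ltr0n ?fact_gt0//; apply: le_trans h.
  by rewrite lerDr.
rewrite expRN ler_pdivrMr ?expR_gt0// mulrAC -ler_pdivrMr ?exprn_gt0//.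
by rewrite -exprVn -exprD addn2.
Qed.

Lemma is_derive_inv (x : R) : x != 0 -> is_derive x 1 (@GRing.inv R) (- x^-1 ^+ 2).
Proof.
move=> x0; apply: DeriveDef; first exact: (@derivableV _ _ id x 1 x0).
by rewrite (@deriveV _ _ id x 1)// derive_id [LHS]mulr1 exprVn.
Qed.

Lemma is_derive_theta k s :
  is_derive s 1 (theta k) (theta k.+2 s - k%:R * theta k.+1 s).
Proof.
have [s0|s0|->] := ltgtP s 0.
- have -> : theta k.+2 s - k%:R * theta k.+1 s = 0.
    by rewrite /theta lt_gtF// mulr0 subr0.
  have h : \near s, cst 0 s = theta k s.
    by near=> t; rewrite /theta lt_gtF//; near: t; exact: lt_nbhsl.
  exact: near_eq_is_derive h (is_derive_cst _ _ _).
- have s0' : s != 0 by rewrite gt_eqF.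
  have dV := is_derive_inv s0'.
  have dNV : is_derive s 1 (fun t : R => - t^-1) (s^-1 ^+ 2).
    by rewrite -[_ ^+ 2]opprK; exact: is_deriveN dV.
  have dE := @is_derive1_comp _ expR (fun t : R => - t^-1) _ _ _ (is_derive_expR (- s^-1)) dNV.
  have h : \near s, ((@GRing.inv R) ^+ k * (expR \o (fun t : R => - t^-1))) s = theta k s.
    by near=> t; rewrite /theta ifT ?fctE//; near: t; exact: lt_nbhsr.
  apply: (near_eq_is_derive h); apply: (is_derive_eq (is_deriveM (is_deriveX k dV) dE)).
  rewrite /theta s0 !exprfctE /= /GRing.scale/= .
  case: k {h} => [|k] /=; first by rewrite !expr0; ring.
  by rewrite !exprS; ring.
- have lim0 : h^-1 *: (theta k (h *: (1:R) + 0) - theta k 0) @[h --> 0^'] --> (0:R).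
    apply/cvgrPdist_le => e e0.
    pose C : R := k.+2`!%:R.
    have C0 : 0 < C by rewrite ltr0n fact_gt0.
    near=> h; rewrite sub0r normrN addr0 [h *: 1]mulr1 {2}/theta ltxx subr0.
    have h0 : h != 0 by near: h; exact: nbhs_dnbhs_neq.
    rewrite normrZ normfV ler_pdivrMl ?normr_gt0//.
    rewrite (le_trans (theta_le _ _))// -[h ^+ 2]real_normK ?num_real// expr2.
    rewrite mulrCA ler_wpM2l//.
    rewrite -ler_pdivlMl// mulrC; near: h; apply: dnbhs0_le.
    by rewrite divr_gt0.
  rewrite {2 3}/theta ltxx mulr0 subr0.
  apply: DeriveDef; last exact: cvg_lim lim0.
  by apply/cvg_ex; exists 0.
Unshelve. all: by end_near. Qed.

End theta.

Section smooth_functions.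
Context (R : realType) (n : nat).
Local Notation V := 'rV[R]_n.
Implicit Types (f g : V -> R) (i : 'I_n).

Lemma differentiable_comp1 f (h : R -> R) x dh :
  differentiable f x -> is_derive (f x) 1 h dh -> differentiable (h \o f) x.
Proof.
move=> df [/derivable1_diffP hh _]; exact: differentiable_comp.
Qed.

Lemma partial_comp1 i f (h : R -> R) x dh :
  differentiable f x -> is_derive (f x) 1 h dh ->
  partial i (h \o f) x = dh * partial i f x.
Proof.
move=> df dfh; have dhf := differentiable_comp1 df dfh.
case: dfh => /derivable1_diffP hh hE.
rewrite /partial (deriveE _ dhf) (deriveE _ df) diff_comp//=.
rewrite deriv1E; last exact/derivable1_diffP.
by rewrite derive1E hE mulrC.
Qed.

Lemma partialD i f g x : differentiable f x -> differentiable g x ->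
  partial i (f \+ g) x = partial i f x + partial i g x.
Proof. by move=> df dg; rewrite /partial deriveD//; exact: diff_derivable. Qed.

Lemma partialM i f g x : differentiable f x -> differentiable g x ->
  partial i (f \* g) x = f x * partial i g x + g x * partial i f x.
Proof. by move=> df dg; rewrite /partial deriveM//; exact: diff_derivable. Qed.

Lemma partial_cst i (c : R) x : partial i (cst c) x = 0.
Proof. exact: derive_cst. Qed.

Lemma partial_coord i j (x : V) : partial i (fun y : V => y 0 j) x = (i == j)%:R.
Proof.
have := @derive_mx R V 1 n id x (delta_mx 0 i) (@derivable_id _ V x (delta_mx 0 i)).
move/(congr1 (fun M : V => M 0 j)).
by rewrite derive_id !mxE eqxx/= eq_sym /partial => ->.
Qed.

Lemma is_derive_rsqrt (s : R) : 0 < s ->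
  is_derive s 1 (fun t => (Num.sqrt t)^-1) (- 2^-1 * (Num.sqrt s)^-1 ^+ 3).
Proof.
move=> s0; have s0' : Num.sqrt s != 0 by rewrite gt_eqF// sqrtr_gt0.
have := @is_derive1_comp _ (@GRing.inv R) (@Num.sqrt R) _ _ _
  (is_derive_inv s0') (is_derive1_sqrt s0).
by move=> h; apply: (is_derive_eq h); rewrite invfM; ring.
Qed.

(* A class of smooth functions, stable under partial derivatives, that contains the bubbles and
   their cutoffs. *)
Inductive elementary : (V -> R) -> Prop :=
| el_cst (c : R) : elementary (cst c)
| el_coord i : elementary (fun x => x 0 i)
| el_add f g : elementary f -> elementary g -> elementary (f \+ g)
| el_mul f g : elementary f -> elementary g -> elementary (f \* g)
| el_rsqrt f : elementary f -> (forall x, 0 < f x) ->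
    elementary (fun x => (Num.sqrt (f x))^-1)
| el_theta k f : elementary f -> elementary (theta k \o f).

Lemma el_exp f k : elementary f -> elementary (fun x => f x ^+ k).
Proof.
move=> ef; elim: k => [|k IH]; first exact: (el_cst 1).
by under eq_fun do rewrite exprS; exact: el_mul.
Qed.

Lemma el_sum I (s : seq I) (F : I -> V -> R) :
  (forall j, elementary (F j)) -> elementary (fun x => \sum_(j <- s) F j x).
Proof.
move=> eF; elim: s => [|j s IH].
  by under eq_fun do rewrite big_nil; exact: (el_cst 0).
by under eq_fun do rewrite big_cons; exact: el_add.
Qed.

(** The two claims share one induction because the product and chain rules for [partial] need the
    differentiability of the parts. Stability under [partial] then upgrades first-order
    differentiability to smoothness. *)
Lemma elementary_differentiable_partial f : elementary f ->
  (forall x, differentiable f x) /\ forall i, elementary (partial i f).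
Proof.
elim=> {f} [c|j|f g ef [df pf] eg [dg pg]|f g ef [df pf] eg [dg pg]
  |f ef [df pf] f0|k f ef [df pf]]; split.
- by move=> x; exact: differentiable_cst.
- move=> i; rewrite (_ : partial i _ = cst 0); first exact: el_cst.
  by apply/funext => x; rewrite partial_cst.
- by move=> x; exact: differentiable_coord.
- move=> i; rewrite (_ : partial i _ = cst (i == j)%:R); first exact: el_cst.
  by apply/funext => x; rewrite partial_coord.
- by move=> x; exact: differentiableD.
- move=> i; rewrite (_ : partial i _ = partial i f \+ partial i g).
    exact: el_add.
  by apply/funext => x; rewrite partialD.
- by move=> x; exact: differentiableM.
- move=> i; rewrite (_ : partial i _ = f \* partial i g \+ g \* partial i f).
    by apply: el_add; exact: el_mul.
  by apply/funext => x; rewrite partialM.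
- by move=> x; exact: (differentiable_comp1 (df x) (is_derive_rsqrt (f0 x))).
- move=> i; rewrite (_ : partial i _ = cst (- 2^-1) \*
    (fun x => (Num.sqrt (f x))^-1 ^+ 3) \* partial i f).
    apply: el_mul => //; apply: el_mul; first exact: el_cst.
    by apply: el_exp; exact: el_rsqrt.
  apply/funext => x.
  by rewrite (partial_comp1 i (df x) (is_derive_rsqrt (f0 x))).
- by move=> x; exact: (differentiable_comp1 (df x) (is_derive_theta k (f x))).
- move=> i; rewrite (_ : partial i _ = (theta k.+2 \o f \+
    cst (- k%:R) \* (theta k.+1 \o f)) \* partial i f).
    apply: el_mul => //; apply: el_add; first exact: el_theta.
    by apply: el_mul; [exact: el_cst|exact: el_theta].
  apply/funext => x; rewrite (partial_comp1 i (df x) (is_derive_theta k (f x))).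
  by rewrite /= mulNr.
Qed.

Lemma elementary_partial f i : elementary f -> elementary (partial i f).
Proof. by move=> /elementary_differentiable_partial[]. Qed.

Lemma elementary_smooth f : elementary f -> smooth f.
Proof.
move=> ef s; suff : elementary (foldr (@partial R n) f s).
  by case/elementary_differentiable_partial.
by elim: s => // i s IH; exact: elementary_partial.
Qed.

Lemma smooth_differentiable f x : smooth f -> differentiable f x.
Proof. by move=> sf; exact: (sf [::]). Qed.

Lemma smooth_partial f i : smooth f -> smooth (partial i f).
Proof. by move=> sf s x; have := sf (rcons s i) x; rewrite foldr_rcons. Qed.

Lemma smooth_continuous f : smooth f -> continuous f.
Proof.
by move=> sf x; exact/differentiable_continuous/smooth_differentiable.
Qed.

End smooth_functions.

(** * Test functions on the unit ball *)

Section unit_ball_facts.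
Context (R : realType) (n : nat).
Local Notation V := 'rV[R]_n.
Local Notation B1 := (unit_ball R n).
Local Notation mu := (lebesgue_rV R n).
Implicit Types (f g phi : V -> R) (x : V).

Lemma dot_ge0 x : 0 <= dot x x.
Proof. by apply: sumr_ge0 => i _; rewrite -expr2 sqr_ge0. Qed.

Lemma sqr_coord_le_dot x i : x 0 i ^+ 2 <= dot x x.
Proof.
rewrite /dot (bigD1 i)//= -expr2 lerDl.
by apply: sumr_ge0 => j _; rewrite -expr2 sqr_ge0.
Qed.

Lemma enorm_sqr x : enorm x ^+ 2 = dot x x.
Proof. by rewrite sqr_sqrtr// dot_ge0. Qed.

Lemma unit_ballE x : B1 x <-> dot x x < 1.
Proof.
rewrite /unit_ball /= /enorm -{1}sqrtr1 ltr_sqrt//.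
Qed.

Lemma dot_ltr_coord x (r : R) : 0 <= r -> dot x x < r ^+ 2 ->
  forall i, `|x 0 i| < r.
Proof.
move=> r0 xr i; rewrite -(@ltr_pXn2r _ 2)// ?nnegrE// real_normK ?num_real//.
exact: le_lt_trans (sqr_coord_le_dot _ _) xr.
Qed.

Lemma unit_ball_coord x : B1 x -> forall i, `|x 0 i| < 1.
Proof. by move=> /unit_ballE x1; apply: dot_ltr_coord => //; rewrite expr1n. Qed.

Lemma continuous_mulr f g : continuous f -> continuous g ->
  continuous (fun x => f x * g x).
Proof. by move=> cf cg x; exact: (continuousM (cf x) (cg x)). Qed.

Lemma continuous_addr f g : continuous f -> continuous g ->
  continuous (fun x => f x + g x).
Proof. by move=> cf cg x; exact: (continuousD (cf x) (cg x)). Qed.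

Lemma continuous_invr f : continuous f -> (forall x, 0 < f x) ->
  continuous (fun x => (f x)^-1).
Proof.
move=> cf f0 x; apply: (@continuous_comp _ _ _ f (@GRing.inv R) x (cf x)).
by apply: inv_continuous; rewrite gt_eqF.
Qed.

Lemma elementary_dot : elementary (fun x : V => dot x x).
Proof. by apply: el_sum => i; apply: el_mul; exact: el_coord. Qed.

Lemma continuous_elementary f : elementary f -> continuous f.
Proof. by move=> /elementary_smooth; exact: smooth_continuous. Qed.

Lemma measurable_unit_ball : measurable B1.
Proof.
rewrite (_ : B1 = (fun x : V => dot x x) @^-1` `]-oo, 1[%classic).
  rewrite -[X in measurable X]setTI.
  apply: (continuous_measurable_rV (continuous_elementary elementary_dot)) => //.
by apply/seteqP; split=> x /=; rewrite in_itv/= => /unit_ballE.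
Qed.

Lemma lebesgue_cube (r : R) : 0 <= r ->
  mu [set x : V | forall i, `|x 0 i| < r] = ((2 * r) ^+ n)%:E.
Proof.
move=> r0; rewrite (_ : [set _ | _] =
  [set x : V | forall i, `]-r, r[%classic (x 0 i)]); last first.
  by apply/seteqP; split=> x /= h i; have := h i; rewrite /= in_itv/= ltr_norml.
rewrite (@lebesgue_rV_box _ _ (fun=> `]-r, r[%classic)); last first.
  by move=> i; exact: measurable_itv.
rewrite (eq_bigr (fun=> (2 * r)%:E)) => [|i _].
  by rewrite prodEFin prodr_const card_ord.
rewrite lebesgue_measure_itv/= lte_fin; case: ltP => rr.
  by rewrite -EFinD opprK mulr_natl mulr2n.
have -> : r = 0 by apply/le_anti; rewrite r0 andbT; lra.
by rewrite mulr0.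
Qed.

Lemma measurable_cube (r : R) : measurable [set x : V | forall i, `|x 0 i| < r].
Proof.
rewrite (_ : [set _ | _] = [set x : V | forall i, `]-r, r[%classic (x 0 i)]).
  by apply: (@measurable_rV_box _ _ (fun=> `]-r, r[%classic)) => i;
    exact: measurable_itv.
by apply/seteqP; split=> x /= h i; have := h i; rewrite /= in_itv/= ltr_norml.
Qed.

Lemma lebesgue_unit_ball_lty : (mu B1 < +oo)%E.
Proof.
apply: (@le_lt_trans _ _ (mu [set x : V | forall i, `|x 0 i| < 1])).
  apply: le_measure; rewrite ?inE; [exact: measurable_unit_ball|
    exact: measurable_cube|exact: unit_ball_coord].
by rewrite lebesgue_cube// ltry.
Qed.

Lemma continuous_bounded_cube f : continuous f ->
  exists M : R, forall x : V, (forall j, `|x 0 j| <= 1) -> `|f x| <= M.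
Proof.
move=> cf.
pose A : set V := [set x | forall i, `[-1, 1]%classic (x 0 i)].
have cA : compact A.
  by apply: (@rV_compact R n (fun=> `[-1, 1]%classic)) => i; exact: segment_compact.
have A0 : A !=set0 by exists 0 => i /=; rewrite mxE in_itv/= lerN10 ler01.
have [|c _ Hc] := @EVT_max_rV R n (fun x => `|f x|) A A0 cA.
  by apply: continuous_subspaceT => x; exact: (continuous_comp (cf x) (@norm_continuous _ R^o _)).
exists `|f c| => x x1; apply: Hc; rewrite inE => i /=.
by rewrite in_itv/= -ler_norml.
Qed.

Lemma integrable_unit_ball f : continuous f -> mu.-integrable B1 (EFin \o f).
Proof.
move=> cf; apply: measurable_bounded_integrable.
- exact: measurable_unit_ball.
- exact: lebesgue_unit_ball_lty.
- by apply: measurable_funTS; exact: continuous_measurable_rV.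
- have /= [M HM] := continuous_bounded_cube cf.
  exists M; split; rewrite ?num_real// => y /ltW My x /unit_ball_coord x1.
  by apply: le_trans My; apply: HM => j; exact/ltW/x1.
Qed.

(** The closed support lies in the open ball, so [phi] vanishes on a whole neighbourhood of [x],
    even when [x] is on the sphere. *)
Lemma test_function_eq0 phi i x : test_function phi -> ~ B1 x ->
  phi x = 0 /\ partial i phi x = 0.
Proof.
move=> [_ _ sB] nBx.
have h : \near x, cst 0 x = phi x.
  have : nbhs x (~` closure [set x | phi x != 0]).
    apply: open_nbhs_nbhs; split; first exact/closed_openC/closed_closure.
    by move=> /sB.
  apply: filterS => y ny; apply/esym/eqP; apply: contrapT => /negP py.
  by apply: ny; exact: subset_closure.
split; first by rewrite -(nbhs_singleton h).
by rewrite /partial -(near_eq_derive _ h) derive_cst.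
Qed.

(** The factor [phi] removes every boundary term, so [g] may be any smooth function, whatever its
    values on the sphere. *)
Lemma integral_partial_test phi g i : test_function phi -> smooth g ->
  (\int[mu]_(x in B1) (partial i (phi \* g) x)%:E = 0)%E.
Proof.
move=> tphi sg; have [sphi _ _] := tphi.
have dphi x : differentiable phi x by exact: smooth_differentiable.
have dg x : differentiable g x by exact: smooth_differentiable.
have E : partial i (phi \* g) = (fun x => phi x * partial i g x + g x * partial i phi x).
  by apply/funext => x; rewrite partialM.
have cw : continuous (partial i (phi \* g)).
  by rewrite E; apply: continuous_addr; apply: continuous_mulr;
    apply: smooth_continuous => //; exact: smooth_partial.
have w0 x : ~ B1 x -> (phi \* g) x = 0 /\ partial i (phi \* g) x = 0.
  by move=> /(test_function_eq0 i tphi)[p0 p1]; rewrite E /= p0 p1 !mul0r mulr0 addr0.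
have nB x : (exists j, 1 <= `|x 0 j|) -> ~ B1 x.
  by move=> [j x1] /unit_ball_coord/(_ j); rewrite ltNge x1.
have [M HM] := continuous_bounded_cube cw.
have M0 : 0 <= M.
  by apply: le_trans (HM 0 _) => // j; rewrite mxE normr0.
rewrite integral_mkcond (_ : _ \_ B1 = EFin \o partial i (phi \* g)); last first.
  apply/funext => x; rewrite patchE; case: ifPn => // /negP; rewrite inE => xB.
  by rewrite /= (w0 x xB).2.
apply: (integral_partial (M := M)).
- by move=> x; apply: diff_derivable; exact: differentiableM.
- move=> x h; apply: (@continuous_comp _ _ _ (fun h : R => h *: delta_mx 0 i + x)).
    by apply: cvgD; [apply: cvgZr_tmp; exact: cvg_id|exact: cvg_cst].
  exact: cw.
- exact: continuous_measurable_rV.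
- move=> x; have [xB|/w0[_ ->]] := pselect (B1 x); last by rewrite normr0.
  by apply: HM => j; exact/ltW/unit_ball_coord.
- by move=> x /nB/w0.
Qed.

Lemma weak_partial_smooth phi g i : test_function phi -> smooth g ->
  (\int[mu]_(x in B1) (g x * partial i phi x)%:E =
   - \int[mu]_(x in B1) (partial i g x * phi x)%:E)%E.
Proof.
move=> tphi sg; have [sphi _ _] := tphi.
have i1 : mu.-integrable B1 (fun x => (g x * partial i phi x)%:E).
  apply: integrable_unit_ball; apply: continuous_mulr;
    apply: smooth_continuous => //; exact: smooth_partial.
have i2 : mu.-integrable B1 (fun x => (partial i g x * phi x)%:E).
  apply: integrable_unit_ball; apply: continuous_mulr;
    apply: smooth_continuous => //; exact: smooth_partial.
have := integral_partial_test i tphi sg.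
under eq_integral => x _.
  rewrite partialM; [|exact: smooth_differentiable..].
  rewrite addrC [phi x * _]mulrC EFinD; over.
rewrite integralD//; last exact: measurable_unit_ball.
have := integrable_fin_num measurable_unit_ball i1.
have := integrable_fin_num measurable_unit_ball i2.
set a := integral _ _ _; set b := integral _ _ _.
case: a => // a _; case: b => // b _; rewrite -EFinD => -[ab].
by rewrite -EFinN; congr (_%:E); lra.
Qed.

(** In the ball the integrand is the divergence of [phi] times the gradient of [u], and each of its
    [n] terms integrates to 0. *)
Lemma weak_solution_smooth d u : smooth u ->
  (forall x, B1 x -> \sum_(i < n) partial i (partial i u) x = d x * u x) ->
  weak_solution d u (grad u).
Proof.
move=> su Hu phi tphi F; have [sphi _ _] := tphi.
have FE : {in B1, F =1 fun x => (\sum_(i < n) (partial i (phi \* partial i u) x)%:E)%E}.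
  move=> x; rewrite inE => Bx; rewrite /F -Hu// /dot mulr_suml -big_split/=.
  rewrite sumEFin; congr (_%:E); apply: eq_bigr => i _; rewrite !mxE.
  rewrite partialM; last 2 first.
    exact: smooth_differentiable.
    exact/smooth_differentiable/smooth_partial.
  by rewrite addrC [phi x * _]mulrC.
have iF i : mu.-integrable B1 (fun x => (partial i (phi \* partial i u) x)%:E).
  apply: integrable_unit_ball.
  rewrite (_ : partial _ _ = fun x =>
      phi x * partial i (partial i u) x + partial i u x * partial i phi x).
    by apply: continuous_addr; apply: continuous_mulr;
      apply: smooth_continuous => //; do ?apply: smooth_partial.
  apply/funext => x; rewrite partialM//; first exact: smooth_differentiable.
  exact/smooth_differentiable/smooth_partial.
split.
  apply: (eq_integrable measurable_unit_ball
    (fun x => (\sum_(i < n) (partial i (phi \* partial i u) x)%:E)%E)).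
    by move=> x xB; rewrite FE.
  by apply: (integrable_sum measurable_unit_ball) => i _; exact: iF.
rewrite [LHS](_ : _ = \int[mu]_(x in B1)
    (\sum_(i < n) (partial i (phi \* partial i u) x)%:E))%E; last exact: eq_integral.
rewrite integral_sum//; last exact: measurable_unit_ball.
by rewrite big1// => i _; apply: integral_partial_test => //; exact: smooth_partial.
Qed.

End unit_ball_facts.

(** * Membership in W_0^{1,2} *)

Section L2norm_facts.
Context (R : realType) (n : nat).
Local Notation V := 'rV[R]_n.
Local Notation B1 := (unit_ball R n).
Local Notation mu := (lebesgue_rV R n).
Implicit Types (f g h : V -> R) (x : V).

Lemma L2norm_le h (c : R) : 0 <= c ->
  (\int[mu]_(x in B1) (h x ^+ 2)%:E <= (c ^+ 2)%:E)%E -> (L2norm h <= c%:E)%E.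
Proof.
move=> c0 hc; rewrite /L2norm unlock.
have -> : (\int[mu]_x `|((EFin \o h) \_ B1) x| `^ 2 =
           \int[mu]_(x in B1) (h x ^+ 2)%:E)%E.
  rewrite [RHS]integral_mkcond; apply: eq_integral => x _; rewrite !patchE.
  case: ifPn => _ /=; last by rewrite normr0 powR0.
  by rewrite powR_mulrn// real_normK ?num_real.
apply: (@le_trans _ _ (((c ^+ 2)%:E `^ 2^-1)%E)).
  apply: gt0_ler_poweR => //; rewrite ?invr_ge0// in_itv/= leey andbT.
    by apply: integral_ge0 => x _; rewrite lee_fin sqr_ge0.
  by rewrite lee_fin sqr_ge0.
by rewrite poweR_EFin lee_fin powR12_sqrt ?sqr_ge0// sqrtr_sqr ger0_norm.
Qed.

(** Dominated convergence with a constant dominating function, as [g] is bounded on the ball.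
    Squares are compared so that the lemma serves both the error in [u], with [g = u^2], and the
    error in the gradient, with [g = |grad u|^2]. *)
Lemma L2norm_cutoff (r : nat -> V -> R) (h : nat -> V -> R) g :
  (forall k, continuous (r k)) -> continuous g ->
  (forall k x, B1 x -> `|r k x| <= 1) ->
  (forall x, B1 x -> r k x @[k --> \oo] --> 0) ->
  (forall k x, h k x ^+ 2 = r k x ^+ 2 * g x) ->
  forall e : R, 0 < e -> \forall k \near \oo, (L2norm (h k) < e%:E)%E.
Proof.
move=> cr cg r1 r0 hE e e0.
have [M HM] := continuous_bounded_cube cg.
have cF k : continuous (fun x => h k x ^+ 2).
  under eq_fun do rewrite hE expr2.
  by do !apply: continuous_mulr.
have mF k : measurable_fun B1 (fun x => (h k x ^+ 2)%:E).
  apply/measurable_EFinP; apply: measurable_funTS.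
  exact: continuous_measurable_rV.
have cvg_int : (\int[mu]_(x in B1) (h k x ^+ 2)%:E @[k --> \oo] --> 0)%E.
  have -> : (0 = \int[mu]_(x in B1) (cst 0 x) :> \bar R)%E by rewrite integral0.
  have A : (\forall x \ae mu, B1 x -> (h k x ^+ 2)%:E @[k --> \oo] --> 0)%E.
    apply/aeW => x Bx; apply/fine_cvgP; split; first by near=> k.
    rewrite (_ : fine \o _ = fun k => r k x * r k x * g x); last first.
      by apply/funext => k /=; rewrite hE expr2.
    have := cvgM (cvgM (r0 x Bx) (r0 x Bx)) (cvg_cst (g x)).
    by rewrite !mul0r; exact.
  have B : mu.-integrable B1 (EFin \o cst M).
    by apply: (integrable_unit_ball (f := cst M)); exact: cst_continuous.
  have C : \forall x \ae mu, forall k, B1 x -> (`|(h k x ^+ 2)%:E| <= (EFin \o cst M) x)%E.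
    apply/aeW => x k Bx; rewrite gee0_abs ?lee_fin ?sqr_ge0// hE.
    rewrite (le_trans (ler_norm _))// normrM normrX.
    rewrite -[leRHS]mul1r ler_pM//; first by rewrite expr_le1// r1.
    by apply: HM => j; exact/ltW/unit_ball_coord.
  by have [] := @dominated_convergence _ _ _ mu B1 (@measurable_unit_ball R n)
    (fun k x => (h k x ^+ 2)%:E) (cst 0%E) (EFin \o cst M) mF (measurable_cst _) A B C.
have e2 : 0 < e / 2 by rewrite divr_gt0.
move/fine_cvgP : cvg_int => [ffin /cvgrPdist_lt/(_ _ (exprn_gt0 2 e2))].
move: ffin; apply: filterS2 => k fk; rewrite sub0r normrN /= => hk.
apply: (@le_lt_trans _ _ (e / 2)%:E); last by rewrite lte_fin; lra.
apply: L2norm_le; first exact: ltW.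
rewrite -(fineK fk) lee_fin; apply: le_trans (ltW hk); exact: ler_norm.
Unshelve. all: by end_near. Qed.

End L2norm_facts.

(** * Bounds on the cutoff profiles *)

Section cutoff.
Context (R : realType).
Implicit Types y z : R.

(* Derivative of [(z + 1) * theta 0 z], the profile of the cutoffs [cut u k] at [z = (k + 1) u - 1]
   up to the factor [k + 1]. *)
Definition cutoff' z : R := theta 0 z + (z + 1) * theta 2 z.

Lemma theta0E z : 0 < z -> theta 0 z = expR (- z^-1).
Proof. by move=> z0; rewrite /theta z0 expr0 mul1r. Qed.

Lemma cutoff'E z : 0 < z ->
  cutoff' z = (1 + z^-1 + z^-1 ^+ 2) * expR (- z^-1).
Proof.
move=> z0; rewrite /cutoff' theta0E// /theta z0.
have z1 : z * z^-1 = 1 by rewrite mulfV// gt_eqF.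
have -> : 1 + z^-1 = z * z^-1 * (1 + z^-1) by rewrite z1 mul1r.
by rewrite !expr2 -{1}[expR _]mul1r -z1; ring: z1.
Qed.

Lemma cutoff'_eq0 z : z <= 0 -> cutoff' z = 0.
Proof. by move=> z0; rewrite /cutoff' /theta ltNge z0/= mulr0 addr0. Qed.

Lemma theta0_dist_le1 z : `|1 - theta 0 z| <= 1.
Proof.
have [z0|z0] := ltP 0 z; last by rewrite /theta ltNge z0/= subr0 normr1.
rewrite theta0E//.
have h0 := expR_gt0 (- z^-1).
have h1 : expR (- z^-1) <= 1 by rewrite -[leRHS]expR0 ler_expR oppr_le0 invr_ge0 ltW.
by rewrite ler_norml; apply/andP; split; lra.
Qed.

(** At [y = 1/z] this says [cutoff' z <= 2]. The tangent bound [1 + y <= exp y] grows too slowly for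
    it; its cube at [y/3] suffices. *)
Lemma expR_quadratic y : 0 <= y -> 1 + y + y ^+ 2 <= 2 * expR y.
Proof.
move=> y0; have h := expR_ge1Dx (y / 3).
have -> : expR y = expR (y / 3) ^+ 3.
  by rewrite -expRM_natl; congr expR; field.
have : (1 + y / 3) ^+ 3 <= expR (y / 3) ^+ 3.
  by rewrite lerXn2r ?nnegrE ?expR_ge0//; lra.
move: (expR (y / 3) ^+ 3) => E HE.
(* A hint for [nra], to absorb the negative quadratic term of [2 (1 + y/3)^3 - (1 + y + y^2)]. *)
have : 0 <= y * (y - 2) ^+ 2 by rewrite mulr_ge0// sqr_ge0.
nra.
Qed.

Lemma cutoff'_dist_le1 z : `|1 - cutoff' z| <= 1.
Proof.
have [z0|z0] := ltP 0 z; last by rewrite cutoff'_eq0// subr0 normr1.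
rewrite cutoff'E//; have y0 : 0 <= z^-1 by rewrite invr_ge0 ltW.
have := expR_quadratic y0; have e0 := expR_gt0 (z^-1).
rewrite expRN -ler_pdivrMr// => h.
have h0 : 0 <= (1 + z^-1 + z^-1 ^+ 2) / expR z^-1.
  by rewrite divr_ge0 ?(ltW e0)// !addr_ge0// sqr_ge0.
by rewrite ler_norml; apply/andP; split; lra.
Qed.

Lemma theta0_dist z : 1 <= z -> `|1 - theta 0 z| <= 2 / z.
Proof.
move=> z1; have z0 : 0 < z by lra.
rewrite theta0E//.
have h0 := expR_ge1Dx (- z^-1); have y0 : 0 <= z^-1 by rewrite invr_ge0 ltW.
have h1 : expR (- z^-1) <= 1 by rewrite -[leRHS]expR0 ler_expR oppr_le0.
by rewrite ler_norml; apply/andP; split; lra.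
Qed.

(** With [y = 1/z <= 1], the bounds [1 - y <= exp(-y) <= 1] place [cutoff' z] between [1 - y^3] and
    [1 + y + y^2 <= 1 + 2 y]; hence the constant 2. *)
Lemma cutoff'_dist z : 1 <= z -> `|1 - cutoff' z| <= 2 / z.
Proof.
move=> z1; have z0 : 0 < z by lra.
rewrite cutoff'E//.
have h0 := expR_ge1Dx (- z^-1); have y0 : 0 <= z^-1 by rewrite invr_ge0 ltW.
have y1 : z^-1 <= 1 by rewrite invf_le1.
have h1 : expR (- z^-1) <= 1 by rewrite -[leRHS]expR0 ler_expR oppr_le0.
move: (z^-1) y0 y1 h0 h1 => y y0 y1; move: (expR (- y)) => E h0 h1.
by rewrite ler_norml; apply/andP; split; nra.
Qed.

End cutoff.

Section W012_elementary.
Context (R : realType) (n : nat).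
Local Notation V := 'rV[R]_n.
Local Notation B1 := (unit_ball R n).
Implicit Types (u : V -> R) (x : V).

Let level u (k : nat) x : R := k.+1%:R * u x - 1.

Let elementary_level u k : elementary u -> elementary (level u k).
Proof.
move=> eu; apply: (el_add (g := cst (-1))); last exact: el_cst.
by apply: (el_mul (f := cst _)) => //; exact: el_cst.
Qed.

Let partial_level u k i x : elementary u ->
  partial i (level u k) x = k.+1%:R * partial i u x.
Proof.
move=> eu; have du y : differentiable u y.
  exact/smooth_differentiable/elementary_smooth.
have -> : level u k = (cst k.+1%:R \* u) \+ cst (-1) by [].
rewrite partialD//; last exact: differentiableM.
by rewrite partialM// !partial_cst mulr0 !addr0.
Qed.

Let cvg_level (f : R -> R) u x : 0 < u x ->
  (forall z, 1 <= z -> `|f z| <= 2 / z) ->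
  f (level u k x) @[k --> \oo] --> 0.
Proof.
move=> u0 fz; apply/cvgrPdist_le => e e0; near=> k; rewrite sub0r normrN.
(* From this [k] on, [level u k x >= 2/e + 1]: this is at least 1, and [2 / level u k x <= e]. *)
have hk : (2 / e + 2) / u x <= k.+1%:R.
  near: k; apply: filterS (nbhs_infty_ger ((2 / e + 2) / u x)) => k hk.
  by rewrite (le_trans hk)// ler_nat.
move: hk; rewrite ler_pdivrMr// => hk.
have e2 : 0 <= 2 / e by rewrite divr_ge0// ltW.
have z1 : 1 <= level u k x by rewrite /level; lra.
rewrite (le_trans (fz _ z1))// ler_pdivrMr; last by lra.
by rewrite mulrC -ler_pdivrMr// /level; lra.
Unshelve. all: by end_near. Qed.

Definition cut u (k : nat) : V -> R := u \* (theta 0 \o level u k).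

Let elementary_cut u k : elementary u -> elementary (cut u k).
Proof. by move=> eu; apply: el_mul => //; apply: el_theta; exact: elementary_level. Qed.

(** The chain rule yields a factor [k + 1], but it comes multiplied by [u], and [(k + 1) u = z + 1]
    at [z = level u k x]. The coefficient thus depends on [z] alone, which makes the bounds on it
    uniform in [k]. *)
Lemma partial_cut u k i x : elementary u ->
  partial i (cut u k) x = cutoff' (level u k x) * partial i u x.
Proof.
move=> eu; have d (f : V -> R) : elementary f -> forall y, differentiable f y.
  by move=> ef y; exact/smooth_differentiable/elementary_smooth.
have el := elementary_level k eu.
rewrite partialM; [|exact: d|exact/d/el_theta].
rewrite (partial_comp1 _ (d _ el _) (is_derive_theta _ _)) partial_level//.
by rewrite /cutoff' /= /level; ring.
Qed.

(** [theta 0] vanishes where [u <= 1/(k+1)], so the support lies in the closed set where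
    [u >= 1/(k+1)], which is inside the ball by positivity. *)
Lemma test_function_cut u k : elementary u -> (forall x, B1 x <-> 0 < u x) ->
  test_function (cut u k).
Proof.
move=> eu Bu.
have cu := continuous_elementary eu.
pose A : set V := [set x | k.+1%:R^-1 <= u x].
have cA : closed A.
  apply: (@closed_comp _ _ u [set y | k.+1%:R^-1 <= y]) => [x _|]; first exact: cu.
  exact: closed_ge.
have sA : closure [set x | cut u k x != 0] `<=` A.
  rewrite closureE => x; apply; split=> // y /=; apply: contra_neqT; rewrite -ltNge => uy.
  rewrite /cut /= /theta ltNge ifF ?mulr0//; apply/negbTE; rewrite negbK.
  by rewrite /level subr_le0 -ler_pdivlMl// mulr1 ltW.
have AB : A `<=` B1.
  by move=> x Ax; apply/Bu; apply: lt_le_trans Ax; rewrite invr_gt0.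
split; [exact/elementary_smooth/elementary_cut| |exact: subset_trans AB].
apply: (@subclosed_compact _ _ [set x : V | forall i, `[-1, 1]%classic (x 0 i)]).
- exact: closed_closure.
- by apply: (@rV_compact R n (fun=> `[-1, 1]%classic)) => i; exact: segment_compact.
- move=> x /sA/AB/unit_ball_coord x1 i /=; rewrite in_itv/= -ler_norml; exact: ltW.
Qed.

(** The errors in [u] and in its gradient are the originals multiplied by [1 - theta 0 z] and
    [1 - cutoff' z], where [z = level u k x]. Both factors are at most 1 in absolute value and tend
    to 0 wherever [u > 0], that is, on the whole ball. *)
Lemma W012_elementary u : elementary u -> (forall x, B1 x <-> 0 < u x) ->
  (W12norm u (grad u) < +oo)%E -> W012 u (grad u).
Proof.
move=> eu Bu fin; have su := elementary_smooth eu.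
split.
  split=> //.
  - by apply: measurable_funTS; apply: continuous_measurable_rV; exact: smooth_continuous.
  - apply: measurable_funTS; apply/measurable_fun_rVP => i.
    under eq_fun do rewrite mxE.
    by apply: continuous_measurable_rV; apply: smooth_continuous; exact: smooth_partial.
  - move=> phi tphi i; under [in RHS]eq_integral do rewrite mxE.
    exact: weak_partial_smooth.
move=> e e0; have e2 : 0 < e / 2 by rewrite divr_gt0.
have ce (f : V -> R) : elementary f -> continuous f by exact: continuous_elementary.
have elv k := elementary_level k eu.
have L1 : \forall k \near \oo, (L2norm (fun x => (u x - cut u k x)%R) < (e / 2)%:E)%E.
  apply: (@L2norm_cutoff _ _ (fun k x => 1 - theta 0 (level u k x)) _ (fun x => u x ^+ 2)) => //.
  - move=> k; apply: ce; apply: (el_add (f := cst 1)); first exact: el_cst.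
    under eq_fun do rewrite -mulN1r.
    by apply: (el_mul (f := cst (-1))); [exact: el_cst|exact/el_theta].
  - exact/ce/el_exp.
  - by move=> k x _; exact: theta0_dist_le1.
  - move=> x /Bu ux; apply: (cvg_level (f := fun z => 1 - theta 0 z)) => //.
    exact: theta0_dist.
  - by move=> k x; rewrite /cut /=; ring.
have L2 : \forall k \near \oo,
    (L2norm (fun x => enorm ((grad u x - grad (cut u k) x)%R)) < (e / 2)%:E)%E.
  apply: (@L2norm_cutoff _ _ (fun k x => 1 - cutoff' (level u k x)) _
    (fun x => dot (grad u x) (grad u x))) => //.
  - move=> k; apply: ce; apply: (el_add (f := cst 1)); first exact: el_cst.
    under eq_fun do rewrite -mulN1r.
    apply: (el_mul (f := cst (-1))); first exact: el_cst.
    apply: (el_add (f := theta 0 \o level u k)); first exact: el_theta.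
    apply: (el_mul (g := theta 2 \o level u k)); last exact: el_theta.
    by apply: (el_add (g := cst 1)) => //; exact: el_cst.
  - apply: ce; apply: el_sum => i; under eq_fun do rewrite mxE.
    by apply: el_mul; exact: elementary_partial.
  - by move=> k x _; exact: cutoff'_dist_le1.
  - move=> x /Bu ux; apply: (cvg_level (f := fun z => 1 - cutoff' z)) => //.
    exact: cutoff'_dist.
  - move=> k x; rewrite enorm_sqr /dot mulr_sumr; apply: eq_bigr => i _.
    by rewrite !mxE partial_cut//; ring.
have [k [h1 h2]] : exists k, (L2norm (fun x => (u x - cut u k x)%R) < (e / 2)%:E)%E /\
    (L2norm (fun x => enorm ((grad u x - grad (cut u k) x)%R)) < (e / 2)%:E)%E.
  have [k] := @filter_ex _ \oo _ _ (filterI L1 L2); by exists k.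
exists (cut u k); first exact: test_function_cut.
by rewrite [e in ltRHS]splitr EFinD; apply: lteD.
Qed.

End W012_elementary.

(** * The bubble *)

Section regularized_inverse_distance.
Context (R : realType) (n : nat).
Local Notation V := 'rV[R]_n.
Implicit Types (c : R) (f : V -> R) (x : V) (i : 'I_n).

Lemma partialX i f k x : differentiable f x ->
  partial i (fun y => f y ^+ k) x = k%:R * f x ^+ k.-1 * partial i f x.
Proof.
move=> df; have h := is_deriveX k (is_derive_id (f x) 1).
have -> : (fun y => f y ^+ k) = (id ^+ k : R -> R) \o f.
  by apply/funext => y; rewrite /= exprfctE.
by rewrite (partial_comp1 i df h) /GRing.scale/= mulr1.
Qed.

Lemma partial_sum i (F : 'I_n -> V -> R) x :
  (forall j, differentiable (F j) x) ->
  partial i (fun y => \sum_j F j y) x = \sum_j partial i (F j) x.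
Proof.
move=> dF; rewrite /partial -derive_sum => [|j]; last exact: diff_derivable.
by congr (derive _ _ _); apply/funext => y; rewrite fct_sumE.
Qed.

Lemma partial_dot i x : partial i (fun y => dot y y) x = 2 * x 0 i.
Proof.
have dc (j : 'I_n) : differentiable (fun y : V => y 0 j) x.
  exact: differentiable_coord.
rewrite /dot partial_sum => [|j]; last exact: differentiableM.
under eq_bigr do rewrite partialM// !partial_coord.
rewrite (bigD1 i)//= eqxx mulr1 big1 ?addr0 ?mulr_natl ?mulr2n// => j ji.
by rewrite eq_sym (negbTE ji) mulr0 addr0.
Qed.

(** Two coefficients, so that one computation covers both [s = invdist a 1] and
    [r = invdist 1 a]. *)
Definition invdist c1 c2 x : R := (Num.sqrt (c1 + c2 * dot x x))^-1.

Section properties.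
Variables c1 c2 : R.
Hypotheses (c1_gt0 : 0 < c1) (c2_ge0 : 0 <= c2).
Local Notation w := (invdist c1 c2).

Let base_gt0 x : 0 < c1 + c2 * dot x x.
Proof. by rewrite ltr_pwDl// mulr_ge0// dot_ge0. Qed.

Lemma invdist_gt0 x : 0 < w x.
Proof. by rewrite invr_gt0 sqrtr_gt0. Qed.

Lemma invdist_sqr x : w x ^+ 2 * (c1 + c2 * dot x x) = 1.
Proof. by rewrite exprVn sqr_sqrtr ?(ltW (base_gt0 x))// mulVf// gt_eqF. Qed.

Lemma elementary_invdist : elementary w.
Proof.
apply: el_rsqrt => //; apply: (el_add (f := cst c1)); first exact: el_cst.
by apply: (el_mul (f := cst c2)); [exact: el_cst|exact: elementary_dot].
Qed.

Let diff_invdist x : differentiable w x.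
Proof. exact/smooth_differentiable/elementary_smooth/elementary_invdist. Qed.

Lemma partial_invdist i x : partial i w x = - c2 * x 0 i * w x ^+ 3.
Proof.
have dd : differentiable (fun y : V => dot y y) x.
  exact/smooth_differentiable/elementary_smooth/elementary_dot.
have db : differentiable (cst c1 \+ (cst c2 \* (fun y : V => dot y y))) x.
  by apply: differentiableD => //; exact: differentiableM.
rewrite (partial_comp1 i db (is_derive_rsqrt (base_gt0 x))).
rewrite partialD//; last exact: differentiableM.
rewrite partialM// !partial_cst partial_dot /invdist.
by rewrite /=; move: (Num.sqrt _)^-1 => y; field.
Qed.

Lemma partial_invdistX k i x :
  partial i (fun y => w y ^+ k) x = - (k%:R * c2) * x 0 i * w x ^+ k.+2.
Proof.
rewrite partialX// partial_invdist; case: k => [|k]; first by rewrite !mul0r oppr0 !mul0r.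
by rewrite /= !exprS; ring.
Qed.

Lemma partial2_invdistX k i x :
  partial i (partial i (fun y => w y ^+ k)) x =
  - (k%:R * c2) * w x ^+ k.+2 + k%:R * k.+2%:R * c2 ^+ 2 * x 0 i ^+ 2 * w x ^+ k.+4.
Proof.
have -> : partial i (fun y => w y ^+ k) =
    (cst (- (k%:R * c2)) \* (fun y : V => y 0 i)) \* (fun y => w y ^+ k.+2).
  by apply/funext => y; rewrite partial_invdistX.
have dX : differentiable (fun y => w y ^+ k.+2) x.
  exact/smooth_differentiable/elementary_smooth/el_exp/elementary_invdist.
have dc : differentiable (fun y : V => y 0 i) x by exact: differentiable_coord.
rewrite partialM//; last exact: differentiableM.
rewrite partial_invdistX partialM// partial_cst partial_coord eqxx /=.
by ring.
Qed.

(* The exponent [n - 2] is the one for which the terms of order [|x|^2] cancel. *)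
Lemma laplacian_invdistX k : n = k.+2 -> forall x,
  \sum_i partial i (partial i (fun y => w y ^+ k)) x =
  - (n%:R * k%:R * (c1 * c2)) * w x ^+ k.+4.
Proof.
move=> nk x; under eq_bigr do rewrite partial2_invdistX.
rewrite big_split/= sumr_const card_ord -mulr_suml -mulr_sumr.
rewrite (_ : \sum_i x 0 i ^+ 2 = dot x x); last first.
  by apply: eq_bigr => i _; rewrite expr2.
have nE : n%:R = k.+2%:R :> R by rewrite nk.
rewrite -[_ *+ n]mulr_natl nE; have := invdist_sqr x; move: (w x) (dot x x) => y t h.
(* Inserting [1 = w^2 (c1 + c2 |x|^2)] brings both terms to the power [k + 4] of [w]. *)
rewrite (_ : y ^+ k.+2 = y ^+ k.+2 * (y ^+ 2 * (c1 + c2 * t))); last by rewrite h mulr1.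
by rewrite !exprS; ring.
Qed.

End properties.
End regularized_inverse_distance.

Section bubble.
Context (R : realType) (p : nat) (eta : R).
Hypotheses (p_gt0 : (0 < p)%N) (eta_gt0 : 0 < eta) (eta_lt1 : eta < 1).
Local Notation n := p.+2.
Local Notation V := 'rV[R]_n.
Local Notation B1 := (unit_ball R n).
Implicit Types (x : V).

(** The fourth power makes the concentration scale [sqrt a = eta^2] and the energy-normalising
    factor [a^(p/4) = eta^p] integer powers of [eta]. *)
Let a : R := eta ^+ 4.
Let s : V -> R := invdist a 1.
Let r : V -> R := invdist 1 a.

Let a_gt0 : 0 < a. Proof. exact: exprn_gt0. Qed.
Let a_lt1 : a < 1. Proof. by rewrite exprn_ilt1// ltW. Qed.
Let s_gt0 x : 0 < s x. Proof. exact: invdist_gt0. Qed.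
Let r_gt0 x : 0 < r x. Proof. by apply: invdist_gt0 => //; exact: ltW. Qed.
Let s_sqr x : s x ^+ 2 * (a + dot x x) = 1.
Proof. by rewrite -(invdist_sqr a_gt0 ler01 x) mul1r. Qed.

(* [r ^+ p] is the Kelvin transform of [s ^+ p]; hence [bubble] is odd under the Kelvin
   transform, and it and its Laplacian both vanish on the unit sphere. *)
Definition bubble x : R := eta ^+ p * (s x ^+ p - r x ^+ p).

(* Dividing by [s ^+ p - r ^+ p] after factoring out [s - r] leaves a denominator that is positive
   on the whole space. *)
Definition potential x : R := - (n%:R * p%:R * a) *
  (s x ^+ 4 + r x ^+ p * ((s x + r x) * (s x ^+ 2 + r x ^+ 2)) /
     \sum_(i < p) s x ^+ (p.-1 - i) * r x ^+ i).

Let elementary_s : elementary s. Proof. exact: elementary_invdist. Qed.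
Let elementary_r : elementary r.
Proof. by apply: elementary_invdist => //; exact: ltW. Qed.

Let diffX (f : V -> R) k x : elementary f -> differentiable (fun y => f y ^+ k) x.
Proof. by move=> ef; exact/smooth_differentiable/elementary_smooth/el_exp. Qed.

Let bubbleE : bubble = (cst (eta ^+ p) \* (fun x => s x ^+ p)) \+
  (cst (- eta ^+ p) \* (fun x => r x ^+ p)).
Proof. by apply/funext => x; rewrite /bubble /=; ring. Qed.

Lemma elementary_bubble : elementary bubble.
Proof.
by rewrite bubbleE; apply: el_add; apply: el_mul;
  [exact: el_cst|exact: el_exp|exact: el_cst|exact: el_exp].
Qed.

Let partialZ (c : R) (f : V -> R) i x : differentiable f x ->
  partial i (cst c \* f) x = c * partial i f x.
Proof. by move=> df; rewrite partialM// partial_cst mulr0 addr0. Qed.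

Lemma partial_bubble i x : partial i bubble x =
  - (eta ^+ p * p%:R * x 0 i * (s x ^+ n - a * r x ^+ n)).
Proof.
rewrite bubbleE partialD; last 2 first.
  by apply: differentiableM => //; exact: diffX.
  by apply: differentiableM => //; exact: diffX.
rewrite !partialZ; [|exact: diffX|exact: diffX].
rewrite (partial_invdistX a_gt0 ler01) (partial_invdistX ltr01 (ltW a_gt0)).
by rewrite -/s -/r; ring.
Qed.

Let sum_gt0 x : 0 < \sum_(i < p) s x ^+ (p.-1 - i) * r x ^+ i.
Proof.
rewrite -(prednK p_gt0) big_ord_recr/= ltr_wpDl//; last by rewrite mulr_gt0 ?exprn_gt0.
by apply: sumr_ge0 => i _; rewrite mulr_ge0// exprn_ge0// ltW.
Qed.

(** [s^(p+4) - r^(p+4) = s^4 (s^p - r^p) + r^p (s - r)(s + r)(s^2 + r^2)], and [s - r] is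
    [s^p - r^p] divided by the sum in [potential]. *)
Lemma laplacian_bubble x :
  \sum_i partial i (partial i bubble) x = potential x * bubble x.
Proof.
have E i : partial i (partial i bubble) x =
    eta ^+ p * partial i (partial i (fun y => s y ^+ p)) x -
    eta ^+ p * partial i (partial i (fun y => r y ^+ p)) x.
  have e1 (f : V -> R) : elementary f -> elementary (partial i (fun y => f y ^+ p)).
    by move=> ef; exact/elementary_partial/el_exp.
  have d1 (f : V -> R) : elementary f -> forall y, differentiable (partial i (fun y => f y ^+ p)) y.
    by move=> ef y; exact/smooth_differentiable/elementary_smooth/e1.
  have -> : partial i bubble = (cst (eta ^+ p) \* partial i (fun y => s y ^+ p)) \+
      (cst (- eta ^+ p) \* partial i (fun y => r y ^+ p)).
    apply/funext => y; rewrite bubbleE partialD; last 2 first.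
      by apply: differentiableM => //; exact: diffX.
      by apply: differentiableM => //; exact: diffX.
    by rewrite !partialZ//; exact: diffX.
  rewrite partialD; last 2 first.
    by apply: differentiableM => //; exact: d1.
    by apply: differentiableM => //; exact: d1.
  by rewrite !partialZ ?mulNr//; exact: d1.
under eq_bigr do rewrite E.
have Ls : \sum_i partial i (partial i (fun y => s y ^+ p)) x =
    - (n%:R * p%:R * (a * 1)) * s x ^+ p.+4.
  exact: (laplacian_invdistX a_gt0 ler01 (erefl p.+2)).
have Lr : \sum_i partial i (partial i (fun y => r y ^+ p)) x =
    - (n%:R * p%:R * (1 * a)) * r x ^+ p.+4.
  exact: (laplacian_invdistX ltr01 (ltW a_gt0) (erefl p.+2)).
rewrite sumrB -[X in X - _]mulr_sumr -[X in _ - X]mulr_sumr Ls Lr /potential /bubble.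
have := subrXX (s x) (r x) p; have := sum_gt0 x.
rewrite -(addn4 p) !exprD.
move: (\sum_(i < p) s x ^+ (p.-1 - i) * r x ^+ i) => S.
move: (s x) (r x) (s x ^+ p) (r x ^+ p) => y z P Q S0 PQ.
have -> : P = Q + (y - z) * S by rewrite -PQ addrC subrK.
by field; rewrite gt_eqF.
Qed.

Let r_lt_s x : (r x < s x) = (dot x x < 1).
Proof.
rewrite /s /r /invdist ltf_pV2 ?posrE ?sqrtr_gt0; last 2 first.
  by rewrite ltr_pwDl// mulr_ge0// ?dot_ge0// ltW.
  by rewrite ltr_pwDl// mul1r dot_ge0.
rewrite ltr_sqrt; last by rewrite ltr_pwDl// mulr_ge0// ?dot_ge0// ltW.
have b0 : 0 < 1 - a by rewrite subr_gt0.
rewrite mul1r -subr_gt0 (_ : _ - _ = (1 - a) * (1 - dot x x)); last by ring.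
by rewrite pmulr_rgt0// subr_gt0.
Qed.

Lemma bubble_gt0 x : (0 < bubble x) = (dot x x < 1).
Proof.
rewrite /bubble pmulr_rgt0 ?exprn_gt0// subr_gt0 -r_lt_s.
by apply: ltr_pXn2r => //; rewrite nnegrE ltW.
Qed.

Let unit_ball_lt x : B1 x -> r x < s x.
Proof. by rewrite r_lt_s => /unit_ballE. Qed.

Lemma bubble_ge0 x : dot x x <= 1 -> 0 <= bubble x.
Proof.
rewrite le_eqVlt => /orP[/eqP x1|]; last by rewrite -bubble_gt0 => /ltW.
by rewrite /bubble /s /r /invdist x1 !mulr1 [a + 1]addrC subrr mulr0.
Qed.

Lemma continuous_potential : continuous potential.
Proof.
have ce := @continuous_elementary R n.
apply: continuous_mulr; first exact: cst_continuous.
apply: continuous_addr; first exact/ce/el_exp.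
apply: continuous_mulr.
  apply: ce; apply: el_mul; first exact: el_exp.
  by apply: el_mul; apply: el_add => //; exact: el_exp.
apply: continuous_invr => //.
apply: ce; apply: el_sum => i; apply: el_mul; exact: el_exp.
Qed.

Let D_gt0 x : 0 < a + dot x x.
Proof. by rewrite ltr_pwDl// dot_ge0. Qed.

Let s_expr2 x k : s x ^+ (2 * k) = (a + dot x x) ^- k.
Proof.
rewrite exprM -exprVn; congr (_ ^+ k); apply: (mulIf (lt0r_neq0 (D_gt0 x))).
by rewrite s_sqr mulVf// lt0r_neq0.
Qed.

(** The sum in the denominator contains [r^(p-1)], so [r^p] divided by it is at most [r]. As [r < s]
    in the ball, the second term is at most [s (2 s)(2 s^2) = 4 s^4]; with the first term [s^4] this
    makes 5. *)
Lemma potential_le x : B1 x ->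
  `|potential x| <= 5 * (n%:R * p%:R) * (eta ^+ 4 / (eta ^+ 4 + dot x x) ^+ 2).
Proof.
move=> /unit_ball_lt rs; rewrite -/a -(s_expr2 x 2) /potential.
have S_ge : r x ^+ p <= r x * \sum_(i < p) s x ^+ (p.-1 - i) * r x ^+ i.
  rewrite -[X in _ ^+ X <= _](prednK p_gt0) exprS ler_wpM2l ?(ltW (r_gt0 x))//.
  rewrite -(prednK p_gt0) big_ord_recr/= subnn expr0 mul1r lerDr.
  by apply: sumr_ge0 => i _; rewrite mulr_ge0// exprn_ge0// ltW.
have := sum_gt0 x; have := exprn_gt0 p (r_gt0 x).
move: (\sum_(i < p) s x ^+ (p.-1 - i) * r x ^+ i) S_ge => S.
move: (r x ^+ p) => P PS P0 S0.
have npa : 0 <= n%:R * p%:R * a :> R by rewrite !mulr_ge0// ltW.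
set X := (s x + r x) * _.
have X0 : 0 <= X by rewrite mulr_ge0// addr_ge0 ?sqr_ge0// ltW.
have XS : r x * X <= 4 * s x ^+ 4.
  rewrite /X; move: rs (r_gt0 x) (s_gt0 x); move: (r x) (s x) => z y zy z0 y0.
  rewrite (_ : 4 * y ^+ 4 = y * ((y + y) * (y ^+ 2 + y ^+ 2))); last by ring.
  have zy2 : z ^+ 2 <= y ^+ 2 by rewrite ler_sqr ?nnegrE ltW.
  rewrite ler_pM ?(ltW z0) ?(ltW zy)//.
    by rewrite mulr_ge0 ?addr_ge0 ?sqr_ge0 ?ltW.
  by rewrite ler_pM ?addr_ge0 ?sqr_ge0 ?lerD2l ?(ltW z0) ?(ltW y0) ?(ltW zy).
have PX : P * X / S <= r x * X.
  by rewrite ler_pdivrMr// mulrAC ler_wpM2r.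
have PX0 : 0 <= P * X / S by apply: divr_ge0; [apply: mulr_ge0 => //|]; exact: ltW.
rewrite normrM normrN (ger0_norm npa) ger0_norm ?addr_ge0 ?exprn_ge0 ?(ltW (s_gt0 x))//.
rewrite (_ : 5 * _ * _ = n%:R * p%:R * a * (5 * s x ^+ 4)); last by ring.
by apply: ler_wpM2l => //; lra.
Qed.

(** The exact value is [eta^(-p) - eta^p]; [p >= 1] and [eta < 1] give this simpler bound. *)
Lemma bubble0 : eta^-1 - 1 <= bubble 0.
Proof.
have d0 : dot (0 : V) 0 = 0 by rewrite /dot big1// => i _; rewrite mxE mul0r.
rewrite /bubble /s /r /invdist d0 !mulr0 !addr0 sqrtr1 invr1 expr1n.
rewrite (_ : a = (eta ^+ 2) ^+ 2); last by rewrite -exprM.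
rewrite sqrtr_sqr ger0_norm ?sqr_ge0// mulrBr mulr1.
rewrite -exprMn (_ : eta * _ = eta^-1); last by field; rewrite lt0r_neq0.
apply: lerB; last by rewrite exprn_ile1 ?ltW.
rewrite -{1}[eta^-1]expr1; apply: ler_weXn2l => //.
by rewrite invf_ge1// ltW.
Qed.

Let D_le2 x : B1 x -> a + dot x x <= 2.
Proof. by move=> /unit_ballE x1; have := a_lt1; lra. Qed.

(** The natural exponent is [p]. One factor [eta^4 + |x|^2 <= 2] is given away to reach the density
    that also bounds the gradient. *)
Lemma bubble_sqr_le x : B1 x ->
  bubble x ^+ 2 <= 2 * (eta ^+ (2 * p) / (eta ^+ 4 + dot x x) ^+ p.+1).
Proof.
move=> Bx; rewrite -/a /bubble exprMn -exprM [(p * 2)%N]mulnC [leRHS]mulrCA.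
apply: ler_wpM2l; first by rewrite exprn_ge0 ?ltW.
apply: (@le_trans _ _ (s x ^+ (2 * p))).
  rewrite mulnC exprM ler_sqr ?nnegrE ?exprn_ge0 ?(ltW (s_gt0 x))//.
    by rewrite gerBl exprn_ge0// ltW.
  rewrite subr_ge0 lerXn2r ?nnegrE ?(ltW (s_gt0 x)) ?(ltW (r_gt0 x))//.
  exact/ltW/unit_ball_lt.
rewrite s_expr2 exprS invfM mulrA ler_peMl ?invr_ge0 ?exprn_ge0 ?(ltW (D_gt0 x))//.
by rewrite ler_pdivlMr// mul1r D_le2.
Qed.

(** [0 <= K <= s^(p+2)] in the ball, and the factor [|x|^2 <= eta^4 + |x|^2] lowers the exponent
    from [p + 2] to [p + 1]. *)
Lemma grad_bubble_sqr_le x : B1 x -> enorm (grad bubble x) ^+ 2 <=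
  p%:R ^+ 2 * (eta ^+ (2 * p) / (eta ^+ 4 + dot x x) ^+ p.+1).
Proof.
move=> Bx; rewrite enorm_sqr -/a; set K := s x ^+ n - a * r x ^+ n.
have -> : dot (grad bubble x) (grad bubble x) =
    p%:R ^+ 2 * (eta ^+ (2 * p) * (K ^+ 2 * dot x x)).
  rewrite {1}/dot; under eq_bigr do rewrite !mxE partial_bubble -/K.
  rewrite /dot !mulr_sumr; apply: eq_bigr => i _.
  by rewrite mulnC exprM; ring.
apply: ler_wpM2l; first exact: sqr_ge0.
apply: ler_wpM2l; first by rewrite exprn_ge0 ?ltW.
have rn : r x ^+ n <= s x ^+ n.
  rewrite lerXn2r ?nnegrE ?(ltW (s_gt0 x)) ?(ltW (r_gt0 x))//.
  exact/ltW/unit_ball_lt.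
have rn0 : 0 <= r x ^+ n by rewrite exprn_ge0// ltW.
have arn : a * r x ^+ n <= r x ^+ n by rewrite ler_piMl// ltW.
have arn0 : 0 <= a * r x ^+ n by rewrite mulr_ge0// ltW.
have K2 : K ^+ 2 <= s x ^+ (2 * n).
  by rewrite mulnC exprM ler_sqr ?nnegrE /K; lra.
apply: (@le_trans _ _ (s x ^+ (2 * n) * dot x x)).
  by apply: ler_wpM2r => //; exact: dot_ge0.
rewrite s_expr2 exprS invfM mulrAC ler_piMl ?invr_ge0 ?exprn_ge0 ?(ltW (D_gt0 x))//.
by rewrite mulrC ler_pdivrMr// mul1r lerDr ltW.
Qed.

End bubble.

(** * Energy of the bubble *)

Section dyadic_shells.
Context (R : realType) (p : nat).
Local Notation V := 'rV[R]_p.+2.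
Local Notation B1 := (unit_ball R p.+2).
Local Notation mu := (lebesgue_rV R p.+2).

(** The shell [k = 0] also contains the core [t < e^2], where the lower bound holds thanks to the
    summand [e^2]. *)
Lemma dyadic_shell (e t : R) (L : nat) : 0 <= t -> (0 < L)%N ->
  t < (e * 2 ^+ L) ^+ 2 ->
  exists2 k, (k < L)%N & t < (e * 2 ^+ k.+1) ^+ 2 /\ (e * 2 ^+ k) ^+ 2 <= e ^+ 2 + t.
Proof.
move=> t0; elim: L => // L IH _ tL.
have [tL'|tL'] := ltP t ((e * 2 ^+ L) ^+ 2); last first.
  by exists L => //; split => //; rewrite (le_trans tL')// lerDr sqr_ge0.
case: L IH tL tL' => [_ tL _|L /(_ isT) IH _ tL'].
  by exists 0%N => //; split => //; rewrite ?expr0 mulr1 lerDl.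
by have [k kL H] := IH tL'; exists k => //; exact: ltnW.
Qed.

Lemma sum_half_le (L : nat) : \sum_(k < L) 2^-1 ^+ k <= 2 :> R.
Proof.
suff : \sum_(k < L) 2^-1 ^+ k = 2 - 2 * 2^-1 ^+ L :> R.
  by move=> ->; rewrite gerBl mulr_ge0// exprn_ge0.
elim: L => [|L IH]; first by rewrite big_ord0 expr0 mulr1 subrr.
by rewrite big_ord_recr/= IH exprS; field.
Qed.

(** On shell [k] the integrand is at most [e^p (e 2^k)^(-2p-2)], and the enclosing cube has side
    [4 e 2^k]. The contribution is at most [4^(p+2) 2^(-kp)], summable because [p >= 1], with a
    bound free of [e]. *)
Lemma integral_dyadic_le (e : R) (L : nat) : (0 < p)%N -> (0 < L)%N ->
  0 < e -> e * 2 ^+ L = 1 ->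
  (\int[mu]_(x in B1) (e ^+ p / (e ^+ 2 + dot x x) ^+ p.+1)%:E
    <= (2 * 4 ^+ p.+2)%:E)%E.
Proof.
move=> p0 L0 e0 eL.
pose box k : set V := [set x | forall i, `|x 0 i| < e * 2 ^+ k.+1].
pose c k : R := e ^+ p / (e * 2 ^+ k) ^+ 2 ^+ p.+1.
have rk0 k : 0 < e * 2 ^+ k by rewrite mulr_gt0// exprn_gt0.
have c0 k : 0 <= c k by rewrite divr_ge0// !exprn_ge0 ?(ltW (rk0 k)) ?(ltW e0).
have mB1 := @measurable_unit_ball R p.+2.
have D0 (x : V) : 0 < e ^+ 2 + dot x x by rewrite ltr_pwDl ?exprn_gt0// dot_ge0.
have mI k : measurable_fun B1 (fun x => (c k * \1_(box k) x)%:E).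
  apply/measurable_EFinP; apply: measurable_funM; first exact: measurable_cst.
  by apply: measurable_indic; exact: measurable_cube.
have I0 k x : (0 <= (c k * \1_(box k) x)%:E)%E by rewrite lee_fin mulr_ge0.
apply: (@le_trans _ _ (\int[mu]_(x in B1) \sum_(k < L) (c k * \1_(box k) x)%:E)%E).
  apply: ge0_le_integral => //.
  - move=> x _; rewrite lee_fin divr_ge0// exprn_ge0//; exact: ltW.
  - apply/measurable_EFinP; apply: measurable_funTS; apply: continuous_measurable_rV.
    apply: (continuous_mulr (f := cst (e ^+ p))); first exact: cst_continuous.
    apply: continuous_invr; last by move=> x; rewrite exprn_gt0.
    apply: continuous_elementary; apply: el_exp.
    by apply: (el_add (f := cst _)); [exact: el_cst|exact: elementary_dot].
  - by apply: emeasurable_sum.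
  - move=> x /unit_ballE x1.
    have [|k kL [tk ek]] := dyadic_shell (dot_ge0 x) L0 (e := e).
      by rewrite eL expr1n.
    rewrite (bigD1 (Ordinal kL))//= -[leLHS]adde0; apply: leeD; last first.
      by apply: sume_ge0 => j _; exact: I0.
    rewrite lee_fin indicE mem_set ?mulr1; last by apply: dot_ltr_coord => //; exact: ltW.
    rewrite /c ler_wpM2l ?exprn_ge0 ?(ltW e0)// lef_pV2 ?posrE ?exprn_gt0//.
    by rewrite lerXn2r ?nnegrE ?sqr_ge0// ltW.
rewrite ge0_integral_sum//.
apply: (@le_trans _ _ (\sum_(k < L) (4 ^+ p.+2 * 2^-1 ^+ k)%:E)%E); last first.
  by rewrite sumEFin lee_fin -mulr_sumr mulrC ler_wpM2r ?exprn_ge0// sum_half_le.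
apply: lee_sum => k _; under eq_integral do rewrite EFinM.
rewrite ge0_integralZl//; last 2 first.
  apply/measurable_EFinP; apply: measurable_indic; exact: measurable_cube.
  by rewrite lee_fin.
rewrite integral_indic//; last exact: measurable_cube.
apply: (@le_trans _ _ ((c k)%:E * ((2 * (e * 2 ^+ k.+1)) ^+ p.+2)%:E)%E).
  apply: lee_wpmul2l; first by rewrite lee_fin.
  rewrite -lebesgue_cube; last exact: ltW.
  apply: le_measure; rewrite ?inE; [|exact: measurable_cube|by move=> x []].
  by apply: measurableI => //; exact: measurable_cube.
rewrite -EFinM lee_fin /c.
have -> : e ^+ p / (e * 2 ^+ k) ^+ 2 ^+ p.+1 * (2 * (e * 2 ^+ k.+1)) ^+ p.+2 =
    4 ^+ p.+2 * (2^-1 ^+ k) ^+ p.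
  rewrite [(2 ^+ k.+1)%R]exprS (_ : 2 * (e * (2 * 2 ^+ k)) = 4 * (e * 2 ^+ k)); last by ring.
  have := rk0 k; have : 0 < 2 ^+ k :> R by exact: exprn_gt0.
  rewrite exprVn; move: (2 ^+ k : R) => q q0 eq0.
  (* In the variables [y = e 2^k] and [q = 2^k] all powers of [y] cancel: this is the scale
     invariance. *)
  have -> : e ^+ p = (e * q) ^+ p / q ^+ p by rewrite exprMn mulfK// lt0r_neq0// exprn_gt0.
  move: (e * q) eq0 => y y0.
  have := exprn_gt0 p y0; have := exprn_gt0 p q0.
  rewrite exprVn -[_ ^+ 2 ^+ _]exprM mulnS mulnC exprD exprM expr2 -[p.+2]addn2.
  rewrite [(4 * y) ^+ _]exprMn !exprD.
  move: (y ^+ p) (q ^+ p) => Y Q Q0 Y0.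
  by field; rewrite !lt0r_neq0.
rewrite ler_wpM2l ?exprn_ge0//.
rewrite -[leRHS]expr1; apply: ler_wiXn2l => //.
by rewrite exprn_ile1// invf_le1// ler1n.
Qed.

End dyadic_shells.

(** * The Lorentz norm *)

Section lorentz.
Context (R : realType).

(* Unlike [ge0_le_integral], no measurability of [f] is required. *)
Lemma le_integral_nonmeasurable d (T : measurableType d) (mu : {measure set T -> \bar R})
    (D : set T) (f g : T -> \bar R) :
  (forall x, D x -> 0 <= f x)%E -> (forall x, D x -> f x <= g x)%E ->
  (\int[mu]_(x in D) f x <= \int[mu]_(x in D) g x)%E.
Proof.
move=> f0 fg; rewrite !(integral_mkcond D) !ge0_integralTE; last 2 first.
- by apply: erestrict_ge0 => x Dx; exact: le_trans (f0 x Dx) (fg x Dx).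
- exact: erestrict_ge0.
apply: ereal_sup_le => _ [h hf <-]; exists h => // x.
by rewrite (le_trans (hf x))//; exact: lee_restrict.
Qed.

Variable n : nat.
Hypothesis n_gt0 : (0 < n)%N.
Local Notation V := 'rV[R]_n.
Local Notation B1 := (unit_ball R n).
Local Notation mu := (lebesgue_rV R n).
Variables (b K : R).
Hypotheses (b_gt0 : 0 < b) (K_gt0 : 0 < K).

Let W (t : R) : R := t `^ (2 / n%:R).
Let nR : 0 < n%:R :> R. Proof. by rewrite ltr0n. Qed.
Let D_gt0 t : 0 < b + 4^-1 * W t.
Proof. by rewrite ltr_pwDl// mulr_ge0// powR_ge0. Qed.

(** [W t] is the squared side of the cube of volume [t]; [bound t] is the radial majorant taken at
    half that side. *)
Let bound (t : R) : R := K * (b / (b + 4^-1 * W t) ^+ 2).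

(** The majorant decreases in [|x|], so [|h x| > bound t] forces [|x| < rho], and the level set lies
    in the cube of side [2 rho], of volume exactly [t]. *)
Lemma rearrangement_le (h : V -> R) (t : R) : measurable_fun setT h ->
  (forall x, B1 x -> `|h x| <= K * (b / (b + dot x x) ^+ 2)) ->
  0 < t -> (rearrangement h t <= (bound t)%:E)%E.
Proof.
move=> mh hK t0; pose rho : R := 2^-1 * t `^ (n%:R^-1).
have rho0 : 0 <= rho by rewrite mulr_ge0// powR_ge0.
have rho2 : rho ^+ 2 = 4^-1 * W t.
  rewrite exprMn -[(_ `^ _) ^+ 2]powR_mulrn ?powR_ge0// -powRrM /W [n%:R^-1 * _]mulrC.
  by congr (_ * _); field.
have rhon : (2 * rho) ^+ n = t.
  rewrite /rho mulrA mulfV// mul1r -powR_mulrn ?powR_ge0// -powRrM mulVf ?gt_eqF//.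
  by rewrite powRr1// ltW.
apply: ereal_inf_lbound; exists (bound t) => //; split.
  by rewrite mulr_gt0// divr_gt0// exprn_gt0.
have muE : mu [set x : V | forall i, `|x 0 i| < rho] = t%:E.
  by rewrite lebesgue_cube// rhon.
rewrite -muE; apply: le_measure; rewrite ?inE; [|exact: measurable_cube|].
  have mn : measurable_fun B1 (fun x => `|h x|).
    by apply: measurable_funTS; exact: measurableT_comp.
  rewrite (_ : [set _ | _] = B1 `&` (fun x => `|h x|) @^-1` `]bound t, +oo[%classic).
    by apply: mn => //; exact: measurable_unit_ball.
  by apply/seteqP; split=> x /= [Bx]; rewrite in_itv/= andbT.
move=> x /= [Bx hx]; apply: dot_ltr_coord => //; rewrite rho2.
rewrite ltNge; apply/negP => tx; move: hx; rewrite ltNge => /negP; apply.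
apply: (le_trans (hK x Bx)); rewrite /bound.
rewrite ler_wpM2l ?(ltW K_gt0)// ler_wpM2l ?(ltW b_gt0)//.
rewrite lef_pV2 ?posrE ?exprn_gt0 ?D_gt0 ?ltr_pwDl ?dot_ge0//.
by rewrite lerXn2r ?nnegrE ?lerD2l ?(ltW (D_gt0 _)) ?addr_ge0 ?dot_ge0 ?(ltW b_gt0).
Qed.

Let g (t : R) : R := W t * bound t * t^-1.
(** An antiderivative of [g]: since [W' = (2/n) W / t], substituting [w = W t] leaves
    [(n/2) K b (b + w/4)^-2 dw]. *)
Let G (t : R) : R := - (2 * n%:R * K * b) * (b + 4^-1 * W t)^-1.

Let is_derive_G (t : R) : 0 < t -> is_derive t 1 G (g t).
Proof.
move=> t0; have dW : is_derive t 1 W _ := is_derive1_powR (2 / n%:R) t0.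
have dI := is_deriveD (is_derive_cst b t 1) (is_deriveZ 4^-1 dW).
have D0 : (cst b + 4^-1 \*: W) t != 0 by rewrite gt_eqF//; exact: D_gt0.
have dV := is_derive1_comp (is_derive_inv D0) dI.
have := is_deriveZ (- (2 * n%:R * K * b)) dV.
move=> h; apply: (is_derive_eq h); rewrite /g /bound /GRing.scale/= add0r.
rewrite (_ : (cst b + 4^-1 \*: W) t = b + 4^-1 * W t)//.
rewrite powRB; last by rewrite (gt_eqF t0) implybT.
rewrite powRr1 ?ltW// -/(W t).
have := D_gt0 t; move: (W t) => w w0.
by field; rewrite (gt_eqF t0) (gt_eqF nR) andbT; apply: lt0r_neq0; lra.
Qed.

Let continuous_g (t : R) : 0 < t -> {for t, continuous g}.
Proof.
move=> t0; have cW : {for t, continuous W}.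
  apply: differentiable_continuous; apply/derivable1_diffP.
  by apply: derivable_powR; rewrite in_itv/= t0.
apply: continuousM; last by apply: inv_continuous; rewrite gt_eqF.
apply: continuousM => //; apply: continuousM; first exact: cst_continuous.
apply: continuousM; first exact: cst_continuous.
apply: continuousV; first by rewrite gt_eqF// exprn_gt0.
apply: (@continuous_comp _ _ _ (fun t => b + 4^-1 * W t) (fun z => z ^+ 2)).
  apply: continuousD; first exact: cst_continuous.
  by apply: continuousM => //; exact: cst_continuous.
exact: exprn_continuous.
Qed.

(** [G] increases from [- 2 n K] at 0 to 0 at infinity. The bound is free of [b], which reflects the
    dilation invariance of the norm. *)
Lemma lorentz_norm_le (h : V -> R) : measurable_fun setT h ->
  (forall x, B1 x -> `|h x| <= K * (b / (b + dot x x) ^+ 2)) ->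
  (lorentz_norm h <= (2 * n%:R * K)%:E)%E.
Proof.
move=> mh hK.
have g0 t : 0 < t -> 0 <= g t.
  move=> t0; rewrite mulr_ge0 ?invr_ge0 ?(ltW t0)// mulr_ge0 ?powR_ge0//.
  by rewrite mulr_ge0 ?(ltW K_gt0)// divr_ge0 ?sqr_ge0// ltW.
apply: (@le_trans _ _ (\int[lebesgue_measure]_(t in `]0%R, +oo[) (g t)%:E)%E).
  apply: le_integral_nonmeasurable => t /=; rewrite in_itv/= andbT => t0.
    rewrite !mule_ge0 ?lee_fin ?powR_ge0 ?invr_ge0 ?(ltW t0)//.
    by apply: le_ereal_inf_tmp => _ [r [r0 _] <-]; rewrite lee_fin ltW.
  rewrite /g !EFinM lee_wpmul2r ?lee_fin ?invr_ge0 ?(ltW t0)//.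
  rewrite lee_wpmul2l ?lee_fin ?powR_ge0//.
  exact: rearrangement_le.
(* With [k + 2] the interval is nondegenerate even for [k = 0]. *)
pose F (k : nat) : set R := `[k.+2%:R^-1, k.+2%:R]%classic.
have FE : `]0%R, +oo[%classic = \bigcup_k F k :> set R.
  apply/seteqP; split => [t|t [k _]]; last first.
    rewrite /F /= !in_itv/= andbT => /andP[+ _].
    by apply: lt_le_trans; rewrite invr_gt0.
  rewrite /= in_itv/= andbT => t0.
  have [k _ /(_ k (leqnn k)) /=] := nbhs_infty_ger (Num.max t t^-1).
  rewrite ge_max => /andP[h1 h2]; exists k => //; rewrite /F /= in_itv/=.
  have kk : k%:R <= k.+2%:R :> R by rewrite ler_nat -addn2 leq_addr.
  apply/andP; split; last exact: le_trans kk.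
  by rewrite -[leRHS]invrK lef_pV2 ?posrE ?invr_gt0//; exact: le_trans kk.
have mg : measurable_fun (`]0%R, +oo[%classic : set R) g.
  apply: open_continuous_measurable_fun; first exact: interval_open.
  by move=> t; rewrite inE/= in_itv/= andbT; exact: continuous_g.
have Fpos k t : F k t -> 0 < t.
  by rewrite /F/= in_itv/= => /andP[+ _]; apply: lt_le_trans; rewrite invr_gt0.
have cvgF : (\int[lebesgue_measure]_(t in F k) (g t)%:E @[k --> \oo] -->
    \int[lebesgue_measure]_(t in \bigcup_k F k) (g t)%:E)%E.
  apply: ge0_nondecreasing_set_cvg_integral.
  - move=> i j ij; apply/subsetPset => t; rewrite /F /= !in_itv/= => /andP[h1 h2].
    rewrite (le_trans _ h1) ?lef_pV2 ?posrE ?ler_nat//= (le_trans h2)// ler_nat.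
    exact: ij.
  - by move=> i; exact: measurable_itv.
  - move=> i; apply/measurable_EFinP; apply: measurable_funS mg => // t /Fpos t0.
    by rewrite /= in_itv/= t0.
  - by move=> i t /Fpos t0; rewrite lee_fin g0.
rewrite FE; have /cvg_lim <- // := cvgF.
apply: lime_le; first by apply/cvg_ex; eexists; exact: cvgF.
near=> k.
have k2 : (k.+2%:R^-1 : R) < k.+2%:R.
  by rewrite (@lt_trans _ _ 1)// ?ltr1n// invf_lt1// ltr1n.
rewrite (@continuous_FTC2 _ g G _ _ k2).
- rewrite -EFinB lee_fin /G.
  have D1 t : 0 <= b * (b + 4^-1 * W t)^-1 <= 1.
    rewrite divr_ge0 ?(ltW b_gt0) ?(ltW (D_gt0 _))//=.
    by rewrite ler_pdivrMr// mul1r lerDl mulr_ge0// powR_ge0.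
  have c0 : 0 <= 2 * n%:R * K by rewrite !mulr_ge0// ltW.
  have /andP[h1 _] := D1 k.+2%:R; have /andP[_ h2] := D1 k.+2%:R^-1.
  have h3 := mulr_ge0 c0 h1.
  have h4 : 2 * n%:R * K * (b * (b + 4^-1 * W k.+2%:R^-1)^-1) <= 2 * n%:R * K.
    by rewrite ler_piMr.
  move: h3 h4; rewrite !mulrA !mulNr; lra.
- apply: continuous_in_subspaceT => t; rewrite inE => /Fpos; exact: continuous_g.
- have cG (t : R) : 0 < t -> {for t, continuous G}.
    move=> t0; apply: differentiable_continuous; apply/derivable1_diffP.
    by have [] := is_derive_G t0.
  split.
  + move=> t; rewrite in_itv/= => /andP[h1 _].
    have t0 : 0 < t by apply: lt_trans h1; rewrite invr_gt0.
    by have [] := is_derive_G t0.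
  + by apply: cvg_at_right_filter; apply: cG; rewrite invr_gt0.
  + by apply: cvg_at_left_filter; apply: cG.
- move=> t; rewrite in_itv/= => /andP[h1 _].
  have t0 : 0 < t by apply: lt_trans h1; rewrite invr_gt0.
  by rewrite derive1E; have [_ ->] := is_derive_G t0.
Unshelve. all: by end_near. Qed.

End lorentz.

(** * Energy bound uniform in the concentration parameter *)

Section bubble_energy.
Context (R : realType) (p : nat).
Local Notation V := 'rV[R]_p.+2.
Local Notation B1 := (unit_ball R p.+2).
Local Notation mu := (lebesgue_rV R p.+2).
Hypothesis p_gt0 : (0 < p)%N.
Variables (eta : R) (L : nat).
Hypotheses (eta_gt0 : 0 < eta) (eta_lt1 : eta < 1).
Hypotheses (L_gt0 : (0 < L)%N) (etaL : eta ^+ 2 * 2 ^+ L = 1).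

Let density (x : V) : R := eta ^+ (2 * p) / (eta ^+ 4 + dot x x) ^+ p.+1.

Let L2norm_density (h : V -> R) (c : R) : 0 <= c ->
  continuous (fun x => h x ^+ 2) ->
  (forall x, B1 x -> h x ^+ 2 <= c * density x) ->
  (L2norm h <= (Num.sqrt (c * (2 * 4 ^+ p.+2)))%:E)%E.
Proof.
move=> c0 ch hc; apply: L2norm_le; first exact: sqrtr_ge0.
rewrite sqr_sqrtr; last by do 2 apply: mulr_ge0 => //; exact: exprn_ge0.
have d0 x : 0 <= density x.
  by rewrite divr_ge0 ?exprn_ge0 ?addr_ge0 ?dot_ge0 ?exprn_ge0 ?ltW.
have mB1 := @measurable_unit_ball R p.+2.
have md : measurable_fun B1 density.
  apply: measurable_funTS; apply: continuous_measurable_rV.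
  apply: (continuous_mulr (f := cst _)); first exact: cst_continuous.
  apply: continuous_invr => [|x]; last first.
    by rewrite exprn_gt0// ltr_pwDl ?exprn_gt0// dot_ge0.
  apply: continuous_elementary; apply: el_exp.
  by apply: (el_add (f := cst _)); [exact: el_cst|exact: elementary_dot].
apply: (@le_trans _ _ (\int[mu]_(x in B1) (c%:E * (density x)%:E))%E).
  apply: ge0_le_integral => //.
  - by move=> x _; rewrite lee_fin sqr_ge0.
  - apply/measurable_EFinP; apply: measurable_funTS.
    exact: continuous_measurable_rV.
  - apply/measurable_EFinP; apply: measurable_funM => //; exact: measurable_cst.
rewrite ge0_integralZl//; last 2 first.
- exact/measurable_EFinP.
- by move=> x _; rewrite lee_fin d0.
rewrite EFinM lee_wpmul2l//.
(* The dyadic estimate is applied at the concentration scale [e = eta^2]. *)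
have e2 : 0 < eta ^+ 2 by rewrite exprn_gt0.
have := integral_dyadic_le p_gt0 L_gt0 e2 etaL.
by rewrite -!exprM.
Qed.

Lemma W12norm_bubble_le : (W12norm (bubble (p := p) eta) (grad (bubble (p := p) eta)) <=
  (Num.sqrt (2 * (2 * 4 ^+ p.+2)) + Num.sqrt (p%:R ^+ 2 * (2 * 4 ^+ p.+2)))%:E)%E.
Proof.
have eb := elementary_bubble p eta_gt0.
rewrite /W12norm EFinD; apply: leeD; apply: L2norm_density => //.
- exact/continuous_elementary/el_exp.
- exact: bubble_sqr_le.
- under eq_fun do rewrite enorm_sqr.
  apply: continuous_elementary; apply: el_sum => i; under eq_fun do rewrite mxE.
  by apply: el_mul; exact: elementary_partial.
- exact: grad_bubble_sqr_le.
Qed.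

End bubble_energy.

(** * The sequence of solutions *)

Lemma closure_unit_ball_le (R : realType) n (x : 'rV[R]_n) :
  closure (unit_ball R n) x -> dot x x <= 1.
Proof.
have cA : closed [set y : 'rV[R]_n | dot y y <= 1].
  apply: (@closed_comp _ _ (fun y : 'rV[R]_n => dot y y) [set t | t <= 1]) => [y _|].
    exact: (continuous_elementary (@elementary_dot R n)).
  exact: closed_le.
rewrite closureE => h; apply: (h [set y : 'rV[R]_n | dot y y <= 1]).
by split=> // y /unit_ballE/ltW.
Qed.

Unset Implicit Arguments.

Theorem proposition6p3 (R : realType) (n : nat) (hn : (3 <= n)%N) :
  exists (d u : nat -> 'rV[R]_n -> R) (Du : nat -> 'rV[R]_n -> 'rV[R]_n),
    [/\ (forall N, measurable_fun (unit_ball R n) (d N)) /\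
          (exists M : R, forall N, (lorentz_norm (d N) <= M%:E)%E),
        forall N,
          [/\ W012 (u N) (Du N),
              {within closure (unit_ball R n), continuous (u N)},
              forall x, closure (unit_ball R n) x -> 0 <= u N x
            & weak_solution (d N) (u N) (Du N)],
        exists C : R, forall N, (W12norm (u N) (Du N) <= C%:E)%E
      & u N 0 @[N --> \oo] --> +oo].
Proof.
case: n hn => [|[|p]]// p0; have {}p0 : (0 < p)%N by [].
(* Powers of 1/2 let [2 (N + 1)] dyadic shells starting at radius [eta^2] end exactly at radius 1;
   the exponent [N + 1] keeps [eta < 1] at [N = 0]. *)
pose eta (N : nat) : R := 2^-1 ^+ N.+1.
have eta0 N : 0 < eta N by rewrite exprn_gt0.
have eta1 N : eta N < 1 by rewrite exprn_ilt1// invf_lt1// ltr1n.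
have etaL N : eta N ^+ 2 * 2 ^+ (2 * N.+1) = 1.
  by rewrite /eta -exprM mulnC -exprMn mulVf// expr1n.
have norm_le N := W12norm_bubble_le p0 (eta0 N) (eta1 N) (L := 2 * N.+1) isT (etaL N).
have eb N := elementary_bubble p (eta0 N).
have md N : measurable_fun setT (potential (p := p) (eta N)).
  by apply: continuous_measurable_rV; exact: continuous_potential.
exists (fun N => potential (eta N)), (fun N => bubble (eta N)), (fun N => grad (bubble (eta N))).
split.
- split=> [N|]; first by apply: measurable_funTS; exact: md.
  (* This is [2 n K] with [K = 5 n p], the constant of [potential_le]. *)
  exists (2 * p.+2%:R * (5 * (p.+2%:R * p%:R))) => N.
  apply: (@lorentz_norm_le _ _ _ (eta N ^+ 4)) => //.
  + exact: exprn_gt0.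
  + by rewrite !mulr_gt0// ltr0n.
  + exact: potential_le.
- move=> N; split.
  + apply: W012_elementary => //.
      by move=> x; rewrite bubble_gt0//; exact: unit_ballE.
    exact: le_lt_trans (norm_le N) (ltry _).
  + by apply: continuous_subspaceT; exact: continuous_elementary.
  + by move=> x /closure_unit_ball_le; exact: bubble_ge0.
  + apply: weak_solution_smooth; first exact: elementary_smooth.
    by move=> x _; exact: laplacian_bubble.
- by eexists; exact: norm_le.
- apply/cvgryPge => A; near=> N.
  apply: le_trans (bubble0 p0 (eta0 N) (eta1 N)).
  have AN : A + 1 <= N%:R by near: N; exact: nbhs_infty_ger.
  rewrite /eta exprVn invrK lerBrDr (le_trans AN)//.
  rewrite -natrX ler_nat; apply: ltnW; apply: ltn_trans (ltn_expl _ _) => //.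
Unshelve. all: by end_near. Qed.
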